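(* Fix a compact set $B\subset\mathscr R_{\mathrm{Kaw}}$. There exists $\varepsilon_0=\varepsilon_0(B)>0$ such that for every $0<\varepsilon\le\varepsilon_0$ there exist constants $C_{B,\varepsilon}<\infty$, $c_{B,\varepsilon}>0$ and $n_0=n_0(B,\varepsilon)<\infty$, depending only on $B$ and $\varepsilon$, such that, uniformly over $(p,\beta)\in B$, for every $n\ge n_0$ with $k=Np\in\mathbb Z$ and every bounded $f:\Gamma_{p,\varepsilon}\to\mathbb R$, \[ \operatorname{Var}_{\pi_\varepsilon}(f)\le C_{B,\varepsilon}\,n^2\,\mathcal E_\varepsilon(f,f)+C_{B,\varepsilon}\,e^{-c_{B,\varepsilon}n}\,\|f\|_\infty^2, \] where $\pi_\varepsilon:=\mu_\beta^k(\,\cdot\mid\Gamma_{p,\varepsilon})$ and \[ \mathcal E_\varepsilon(f,f)=\frac12\sum_{x,y\in\Gamma_{p,\varepsilon}}\pi_\varepsilon(x)P_\varepsilon(x,y)\big(f(y)-f(x)\big)^2 . \]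
   Context: Parameter region: for $p\in(0,1)$ let $c_p=\frac{\log(p/(1-p))}{2p-1}$ if $p\ne\frac12$ and $c_{1/2}=2$. $\mathscr R_{\mathrm{Kaw}}=\{(p,\beta):0<p<1,\ 0\le\beta<c_p,\ 4\beta p(1-p)<\tfrac12\}$. Model: $\mathcal I=\binom{[n]}{2}$ is the set of $N=n(n-1)/2$ edge-positions; a simple graph on $[n]$ is identified with $X\in\{0,1\}^{\mathcal I}$. $\Omega_k=\{X\in\{0,1\}^{\mathcal I}:\sum_eX_e=k\}$, where throughout $k=Np$ is an integer. $\mathcal H_\beta(X)=\frac{2\beta}{n}\sum_{v=1}^n\binom{\deg_X(v)}{2}$ and $\mu_\beta^k(X)=e^{\mathcal H_\beta(X)}/\sum_{Y\in\Omega_k}e^{\mathcal H_\beta(Y)}$ for $X\in\Omega_k$. Full (global) Kawasaki kernel $P$ on $\Omega_k$: for $x\in\Omega_k$, $s$ with $x_s=1$ and $t$ with $x_t=0$, let $x^{s\leftrightarrow t}$ be obtained by deleting edge $s$ and adding edge $t$; for $y=x^{s\leftrightarrow t}$, $P(x,y)=\frac1{k(N-k)}\frac{\mu_\beta^k(y)}{\mu_\beta^k(x)+\mu_\beta^k(y)}$; $P(x,y)=0$ for all other $y\ne x$, and $P(x,x)=1-\sum_{y\ne x}P(x,y)$. Regular set: for edge-positions write $f\sim e$ if $f\ne e$ and $f\cap e\neq\varnothing$; $d(e,X)=|\{f\in\mathcal I:X_f=1,f\sim e\}|$, $r(e,X)=d(e,X)/(2n)$, and $\Gamma_{p,\varepsilon}=\{X\in\Omega_k: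 r(e,X)\in[p-\varepsilon,p+\varepsilon]\ \text{for every }e\in\mathcal I\}$. Restricted kernel $P_\varepsilon$ on $\Gamma_{p,\varepsilon}$: $P_\varepsilon(x,y)=P(x,y)$ for $x\neq y$ in $\Gamma_{p,\varepsilon}$ and $P_\varepsilon(x,x)=1-\sum_{y\in\Gamma_{p,\varepsilon},y\ne x}P(x,y)$. *)

(* Defs.v *)
From mathcomp Require Import all_boot all_order all_algebra.
From mathcomp Require Import classical_sets reals topology normedtype sequences exp.
Set Implicit Arguments.
Unset Strict Implicit.
Unset Printing Implicit Defensive.
Import Order.TTheory GRing.Theory Num.Theory.
Import numFieldNormedType.Exports.
Local Open Scope ring_scope.

Definition c_thr (R : realType) (p : R) : R :=
  if p == 2^-1 then 2 else ln (p / (1 - p)) / (2 * p - 1).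

(* Pairs are (p, beta). *)
Definition R_Kaw (R : realType) : set (R * R) :=
  [set pb : R * R | [/\ 0 < pb.1 < 1, 0 <= pb.2 < c_thr pb.1
                      & 4 * pb.2 * pb.1 * (1 - pb.1) < 2^-1]]%classic.

Notation edge n := {e : {set 'I_n} | #|e| == 2%N}.

Notation config n := {ffun edge n -> bool}.

Definition nedges (n : nat) : nat := 'C(n, 2).

Definition Omega (n k : nat) : {set config n} :=
  [set X : config n | (\sum_(e : edge n) X e)%N == k].

Definition deg (n : nat) (X : config n) (v : 'I_n) : nat :=
  #|[set e : edge n | X e & v \in val e]|.

Definition Ham (R : realType) (n : nat) (beta : R) (X : config n) : R :=
  2 * beta / n%:R * \sum_(v < n) 'C(deg X v, 2)%:R.

Definition mu (R : realType) (n k : nat) (beta : R) (X : config n) : R :=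
  if X \in Omega n k
  then expR (Ham beta X) / \sum_(Y in Omega n k) expR (Ham beta Y)
  else 0.

Definition swap (n : nat) (x : config n) (s t : edge n) : config n :=
  [ffun e => if e == s then false else if e == t then true else x e].

Definition is_swap (n : nat) (x y : config n) : bool :=
  [exists s : edge n, exists t : edge n, [&& x s, ~~ x t & y == swap x s t]].

Definition P_offdiag (R : realType) (n k : nat) (beta : R)
    (x y : config n) : R :=
  if is_swap x y
  then (k%:R * ((nedges n)%:R - k%:R))^-1
       * (mu k beta y / (mu k beta x + mu k beta y))
  else 0.

(* Meaningful for x, y in Omega n k. *)
Definition P_Kaw (R : realType) (n k : nat) (beta : R) (x y : config n) : R :=
  if x == y
  then 1 - \sum_(z in Omega n k | z != x) P_offdiag k beta x z
  else P_offdiag k beta x y.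

Definition adj (n : nat) (f e : edge n) : bool :=
  (f != e) && ~~ [disjoint val f & val e].

Definition dcount (n : nat) (e : edge n) (X : config n) : nat :=
  #|[set f : edge n | X f & adj f e]|.

Definition rdens (R : realType) (n : nat) (e : edge n) (X : config n) : R :=
  (dcount e X)%:R / (2 * n%:R).

Definition Gamma (R : realType) (n k : nat) (p eps : R) : {set config n} :=
  [set X in Omega n k |
     [forall e : edge n, p - eps <= rdens R e X <= p + eps]].

(* Meaningful for x, y in Gamma n k p eps. *)
Definition P_eps (R : realType) (n k : nat) (p beta eps : R)
    (x y : config n) : R :=
  if x == y
  then 1 - \sum_(z in Gamma n k p eps | z != x) P_Kaw k beta x z
  else P_Kaw k beta x y.

Definition cond_meas (R : realType) (T : finType) (m : T -> R) (A : {set T})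
    (x : T) : R :=
  if x \in A then m x / \sum_(y in A) m y else 0.

Definition pi_eps (R : realType) (n k : nat) (p beta eps : R) :
    config n -> R :=
  cond_meas (mu k beta) (Gamma n k p eps).

(* Functions on a subset A of T are represented by total functions on T; the
   mean, variance and sup norm below, and Dir_eps, only depend on the restriction to A. *)
Definition mean_on (R : realType) (T : finType) (A : {set T}) (m f : T -> R) : R :=
  \sum_(x in A) m x * f x.

Definition var_on (R : realType) (T : finType) (A : {set T}) (m f : T -> R) : R :=
  \sum_(x in A) m x * (f x - mean_on A m f) ^+ 2.

Definition supnorm_on (R : realType) (T : finType) (A : {set T}) (f : T -> R) : R :=
  \big[Num.max/0]_(x in A) `|f x|.

Definition Dir_eps (R : realType) (n k : nat) (p beta eps : R)
    (f : config n -> R) : R :=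
  2^-1 * \sum_(x in Gamma n k p eps) \sum_(y in Gamma n k p eps)
    pi_eps k p beta eps x * P_eps k p beta eps x y * (f y - f x) ^+ 2.

(* Main.v *)
Require Import Defs.
From mathcomp Require Import all_boot all_order all_algebra.
From mathcomp Require Import classical_sets reals topology normedtype sequences exp.
From mathcomp Require Import derive ring lra zify.
Import Order.TTheory GRing.Theory Num.Theory.
Import numFieldNormedType.Exports.
Local Open Scope ring_scope.

(* As P is self-adjoint in L^2(pi), |P^j F|^2 is log-convex in j, so that
   |P^t F|^2 >= (1 - 2E/V)^t V for a centred F with variance V and
   energy E.  Conversely, run the restricted chain from x and y, coupling the
   swap (s, t) of x with the swap (tau s, tau t) of y, where tau is an
   involution exchanging x \ y and y \ x.  While both copies stay in
   Gamma_{eps/2}, the Hamming distance contracts by 1 - eta/N per step: swaps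
   touching x \ y decrease it at rate about 1/2, the discrepancy of the
   acceptance probabilities increases it at rate at most 4 beta p (1 - p).
   Excursions outside Gamma_{eps/2} have stationary probability O(e^{-cn}): the
   function L = sum_e (e^{lam D_e} + e^{-lam D_e}), D_e = d(e, X) - 2np, has
   negative drift wherever max |D_e| is between eps n / 2 and 3 eps n, and
   truncating L at a level K makes the drift nonpositive outside {L < K}, so
   stationarity bounds the mass of {L < K} \ Gamma_{eps/2}, with
   Gamma_eps included in {L < K}.  For t = n^3 this gives
   |P^t F|^2 <= e^{-2cn} |f|^2, and comparing both bounds gives V <= C n^2 E
   unless V <= e^{-cn} |f|^2. *)

(** * Real inequalities *)

(** The condition 4 beta p (1 - p) < 1/2 is spent twice. In the coupling it compares healing with
    the spread of a disagreement. In the drift, D_e is pulled back at rate 1/2, while deviations of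
    size M bias the acceptance by about beta M / n and so push D_e outwards at rate about 4 beta p
    (1 - p) M.

    Near the boundary of Gamma_eps the restricted kernel may suppress a swap in one copy and not in
    the other, and the coupling yields no contraction there. This is the reason for the two levels
    eps / 2 and eps, and for the additive error in the theorem.

    Nothing is known of mu far from the regular set. Hence the mass of the boundary layer is bounded
    relative to that of Gamma_eps, by an argument that stays local thanks to the truncation.

    The time n^3 balances two needs. As N <= n^2, the factor (1 - eta / N)^(n^3) is at most e^(- eta
    n), and a union bound over n^3 steps costs only a polynomial factor. Conversely, if (1 -
    2E/V)^(n^3) <= e^(-cn), then 2E/V is at least of order c / n^2, which is the factor n^2 of the
    theorem. *)

Definition logistic {R : realType} (u : R) : R := (1 + expR (- u))^-1.

Lemma logistic_gt0 (R : realType) (u : R) : 0 < logistic u.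
Proof. by rewrite invr_gt0 addr_gt0// expR_gt0. Qed.

Lemma logistic_le1 (R : realType) (u : R) : logistic u <= 1.
Proof. by rewrite invf_le1 ?lerDl ?expR_ge0// addr_gt0// expR_gt0. Qed.

Lemma logistic0 (R : realType) : logistic (0 : R) = 2^-1.
Proof. by rewrite /logistic oppr0 expR0. Qed.

(** This is tanh (w / 2) <= w / 2. Multiplied by 2 e^w it becomes 0 <= f w for the [f] below, which
    vanishes at 0 and is nondecreasing because e^(-u) >= 1 - u. *)
Lemma expR_tanh_le (R : realType) (w : R) : 0 <= w ->
  1 - expR (- w) <= w / 2 * (1 + expR (- w)).
Proof.
move=> w0.
pose f (u : R) := expR u * (u - 2) + (u + 2).
have df (u : R) : is_derive u 1 f (expR u * (u - 1) + 1).
  by apply: is_derive_eq; rewrite /GRing.scale /=; ring.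
have f0 : f 0 = 0 by rewrite /f expR0; ring.
have [|c _] := @MVT_segment _ f _ _ _ w0 (fun x _ => df x).
  by apply: derivable_within_continuous => x _; case: (df x).
rewrite f0 !subr0 => fw.
have : 0 <= f w.
  rewrite fw mulr_ge0//.
  have h := expR_ge1Dx (- c).
  have : expR c * (1 - c) <= expR c * expR (- c) by rewrite ler_pM2l ?expR_gt0.
  by rewrite -expRD subrr expR0; lra.
have e : expR w * expR (- w) = 1 by rewrite -expRD subrr expR0.
rewrite /f => h.
have : 0 <= (expR w * (w - 2) + (w + 2)) * expR (- w).
  by rewrite mulr_ge0 ?expR_ge0.
rewrite mulrDl mulrAC e mul1r; lra.
Qed.

(** The constant has to be the sharp 1/4, since it fixes the coefficient in 4 beta p (1 - p). *)
Lemma logistic_lip (R : realType) (u v : R) :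
  `|logistic u - logistic v| <= 4^-1 * `|u - v|.
Proof.
wlog uv : u v / u <= v.
  move=> H; have [/H//|/ltW/H] := leP u v.
  by rewrite distrC [in leRHS]distrC.
have mono : logistic u <= logistic v.
  rewrite /logistic lef_pV2 ?posrE ?addr_gt0 ?expR_gt0//.
  by rewrite lerD2l ler_expR lerN2.
rewrite distrC ger0_norm ?subr_ge0// distrC ger0_norm ?subr_ge0//.
pose w := (v - u) / 2; pose a := expR (- u); pose q := expR (- w).
have w0 : 0 <= w by rewrite /w; lra.
have hw := expR_tanh_le _ _ w0; rewrite -/q in hw.
have -> : v - u = 2 * w by rewrite /w; lra.
have vE : expR (- v) = a * q ^+ 2.
  by rewrite /a /q expr2 -!expRD; congr expR; rewrite /w; lra.
rewrite /logistic vE -/a.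
have a0 : 0 < a := expR_gt0 _.
have q0 : 0 < q := expR_gt0 _.
have ha : 0 < 1 + a by lra.
have hb : 0 < 1 + a * q ^+ 2 by rewrite addr_gt0// mulr_gt0// exprn_gt0.
have -> : (1 + a * q ^+ 2)^-1 - (1 + a)^-1
   = a * (1 - q ^+ 2) / ((1 + a) * (1 + a * q ^+ 2)).
  by field; rewrite !gt_eqF.
rewrite ler_pdivrMr ?mulr_gt0//.
(* This bound on the denominator removes u; what remains is (1 - q) / (1 + q) <= w / 2, the tanh
   bound. *)
have h2 : a * (1 + q) ^+ 2 <= (1 + a) * (1 + a * q ^+ 2).
  rewrite -subr_ge0.
  have -> : (1 + a) * (1 + a * q ^+ 2) - a * (1 + q) ^+ 2 = (1 - a * q) ^+ 2.
    by ring.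
  exact: sqr_ge0.
apply: le_trans (_ : 4^-1 * (2 * w) * (a * (1 + q) ^+ 2) <= _); last first.
  by rewrite ler_wpM2l// mulr_ge0//; lra.
have -> : a * (1 - q ^+ 2) = a * (1 + q) * (1 - q) by ring.
have -> : 4^-1 * (2 * w) * (a * (1 + q) ^+ 2)
  = a * (1 + q) * (w / 2 * (1 + q)) by field.
by rewrite ler_wpM2l// mulr_ge0//; lra.
Qed.

(** From e^y <= 1 / (1 - y) and (1 + y + 2 y^2) (1 - y) = 1 + y^2 (1 - 2 y). *)
Lemma expR_quad_le (R : realType) (y : R) : `|y| <= 2^-1 ->
  expR y <= 1 + y + 2 * y ^+ 2.
Proof.
rewrite ler_norml => /andP[y1 y2].
have h := expR_ge1Dx (- y).
have e0 := expR_gt0 y.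
have eq1 : expR y * expR (- y) = 1 by rewrite -expRD subrr expR0.
have h2 : expR y * (1 - y) <= 1 by rewrite -[leRHS]eq1 ler_pM2l.
have h3 : 1 <= (1 + y + 2 * y ^+ 2) * (1 - y).
  have : 0 <= y ^+ 2 * (1 - 2 * y) by rewrite mulr_ge0 ?sqr_ge0//; lra.
  by rewrite expr2; nra.
rewrite -(@ler_pM2r _ (1 - y)); last lra.
exact: le_trans h2 h3.
Qed.

Lemma expR_natr_poly_le (R : realType) (a : nat) (d y : R) :
  0 < d -> 0 <= y -> y ^+ a <= d ^- a * expR (a%:R * (d * y)).
Proof.
move=> d0 y0; rewrite expRM_natl -exprVn -exprMn lerXn2r ?nnegrE//.
  by rewrite mulr_ge0 ?invr_ge0 ?expR_ge0// ltW.
rewrite ler_pdivlMl//; apply: le_trans (expR_ge1Dx _); lra.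
Qed.

Lemma expR_dominates (R : realType) (K d : R) (a : nat) : 0 < d ->
  exists n0 : nat, forall n : nat, (n0 <= n)%N ->
    K * n%:R ^+ a <= expR (d * n%:R).
Proof.
(* Dividing d by a + 1 yields one more power of n than asked; it absorbs the constant [C]. *)
move=> d0; pose e := d / (a.+1)%:R.
have e0 : 0 < e by rewrite divr_gt0.
pose C := `|K| * e ^- a.+1.
exists (Num.bound `|C|).+1 => n hn.
have Cn : C <= n%:R.
  apply: le_trans (ler_norm _) _; apply: ltW.
  apply: lt_le_trans (archi_boundP (normr_ge0 _)) _.
  by rewrite ler_nat ltnW.
have n1 : 1 <= n%:R :> R by rewrite ler1n (leq_trans _ hn).
have h := @expR_natr_poly_le R a.+1 e n%:R e0 (ler0n _ _).
have E : a.+1%:R * (e * n%:R) = d * n%:R.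
  by rewrite /e mulrA mulrCA mulfV ?mulr1// pnatr_eq0.
rewrite E in h.
rewrite -(@ler_pM2l _ n%:R); last by rewrite (lt_le_trans ltr01).
apply: le_trans (_ : C * expR (d * n%:R) <= _); last first.
  by rewrite ler_wpM2r ?expR_ge0.
rewrite mulrCA -exprS /C -mulrA.
apply: le_trans (_ : `|K| * n%:R ^+ a.+1 <= _).
  by rewrite ler_wpM2r ?ler_norm// exprn_ge0.
by rewrite ler_wpM2l.
Qed.

(** * Reversible chains contracting off a rare set *)

Section ReversibleChain.
Variables (R : realFieldType) (T : finType) (A : {set T}).
Variables (w : T -> R) (K : T -> T -> R).

Definition dot_on (f g : T -> R) : R := \sum_(x in A) w x * (f x * g x).
Definition op_on (f : T -> R) (x : T) : R := \sum_(y in A) K x y * f y.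
Definition dir_on (f : T -> R) : R :=
  2^-1 * \sum_(x in A) \sum_(y in A) w x * K x y * (f y - f x) ^+ 2.

Hypothesis w_ge0 : forall x, 0 <= w x.
Hypothesis w_sum1 : \sum_(x in A) w x = 1.
Hypothesis K_ge0 : forall x y, x \in A -> y \in A -> 0 <= K x y.
Hypothesis K_sum1 : forall x, x \in A -> \sum_(y in A) K x y = 1.
Hypothesis K_rev : forall x y, x \in A -> y \in A -> w x * K x y = w y * K y x.

(** * Lower bound on the iterates of a self-adjoint kernel *)

Lemma dot_on_ge0 f : 0 <= dot_on f f.
Proof. by apply: sumr_ge0 => x _; rewrite mulr_ge0// -expr2 sqr_ge0. Qed.

Lemma dir_on_ge0 f : 0 <= dir_on f.
Proof.
rewrite mulr_ge0 ?invr_ge0 ?ler0n//.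
apply: sumr_ge0 => x xA; apply: sumr_ge0 => y yA.
by apply: mulr_ge0; [apply: mulr_ge0 => //; exact: K_ge0|exact: sqr_ge0].
Qed.

Lemma dot_on_lin a b f g :
  dot_on (fun x => a * f x + b * g x) (fun x => a * f x + b * g x)
  = a ^+ 2 * dot_on f f + 2 * a * b * dot_on f g + b ^+ 2 * dot_on g g.
Proof.
rewrite /dot_on !mulr_sumr -!big_split /=.
by apply: eq_bigr => x _; ring.
Qed.

Lemma dot_on_CS f g : dot_on f g ^+ 2 <= dot_on f f * dot_on g g.
Proof.
have c0 := dot_on_ge0 g; have a0 := dot_on_ge0 f.
set a := dot_on f f; set b := dot_on f g; set c := dot_on g g.
rewrite -/a -/c in a0 c0.
have [cE|cN] := eqVneq c 0; last first.
  have cp : 0 < c by rewrite lt_neqAle eq_sym cN.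
  have := dot_on_ge0 (fun x => c * f x + - b * g x).
  rewrite dot_on_lin -/a -/b -/c => h.
  have : 0 <= c * (a * c - b ^+ 2).
    by apply: le_trans h _; rewrite le_eqVlt; apply/orP; left; apply/eqP; ring.
  by rewrite pmulr_rge0// subr_ge0.
have [->|bN] := eqVneq b 0; first by rewrite expr0n mulr_ge0.
(* If g has norm 0 and b is nonzero, this combination would have squared norm -1. *)
have := dot_on_ge0 (fun x => 1 * f x + - ((a + 1) / (2 * b)) * g x).
rewrite dot_on_lin -/a -/b -/c cE mulr0 addr0.
have -> : 1 ^+ 2 * a + 2 * 1 * - ((a + 1) / (2 * b)) * b = - 1 by field.
by rewrite oppr_ge0 ler10.
Qed.

Lemma dot_on_op_on f g : dot_on (op_on f) g = dot_on f (op_on g).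
Proof.
transitivity (\sum_(x in A) \sum_(y in A) w x * K x y * f y * g x).
  apply: eq_bigr => x _; rewrite mulr_suml mulr_sumr.
  by apply: eq_bigr => y _; ring.
rewrite exchange_big /=; apply: eq_bigr => y yA.
rewrite !mulr_sumr; apply: eq_bigr => x xA.
by rewrite K_rev//; ring.
Qed.

Lemma dot_on_op_on1 g : \sum_(x in A) w x * op_on g x = \sum_(x in A) w x * g x.
Proof.
have := dot_on_op_on g (fun=> 1); rewrite /dot_on /op_on.
under eq_bigr do rewrite mulr1.
move=> ->; apply: eq_bigr => x xA.
by under eq_bigr do rewrite mulr1; rewrite K_sum1// mulr1.
Qed.

Lemma dir_onE f : dir_on f = dot_on f f - dot_on f (op_on f).
Proof.
have e1 : \sum_(x in A) \sum_(y in A) w x * K x y * f x ^+ 2 = dot_on f f.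
  apply: eq_bigr => x xA; rewrite -mulr_suml -mulr_sumr K_sum1//; ring.
have e2 : \sum_(x in A) \sum_(y in A) w x * K x y * f y ^+ 2 = dot_on f f.
  rewrite -e1 exchange_big /=; apply: eq_bigr => y yA; apply: eq_bigr => x xA.
  by rewrite K_rev.
have e3 : \sum_(x in A) \sum_(y in A) w x * K x y * (f x * f y)
   = dot_on f (op_on f).
  by apply: eq_bigr => x xA; rewrite !mulr_sumr; apply: eq_bigr => y yA; ring.
rewrite /dir_on.
have -> : \sum_(x in A) \sum_(y in A) w x * K x y * (f y - f x) ^+ 2
  = \sum_(x in A) \sum_(y in A) w x * K x y * f y ^+ 2
  + \sum_(x in A) \sum_(y in A) w x * K x y * f x ^+ 2
  - 2 * (\sum_(x in A) \sum_(y in A) w x * K x y * (f x * f y)).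
  rewrite mulr_sumr -big_split /= -sumrB; apply: eq_bigr => x xA.
  rewrite mulr_sumr -big_split /= -sumrB; apply: eq_bigr => y yA; ring.
by rewrite e1 e2 e3; field.
Qed.

(** Cauchy-Schwarz gives |f|^2 |P f|^2 >= (f, P f)^2 = (V - E)^2 >= V (V - 2 E). Working with |P
    f|^2 makes the bound independent of the sign of the spectrum. *)
Lemma dot_on_op_on_lower f :
  dot_on f f - 2 * dir_on f <= dot_on (op_on f) (op_on f).
Proof.
have V0 := dot_on_ge0 f; have E0 := dir_on_ge0 f; have a0 := dot_on_ge0 (op_on f).
have h := dot_on_CS f (op_on f).
have [VE|VN] := eqVneq (dot_on f f) 0.
  by rewrite VE sub0r (le_trans _ a0)// oppr_le0 mulr_ge0.
have Vp : 0 < dot_on f f by rewrite lt_neqAle eq_sym VN.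
rewrite -(ler_pM2l Vp); apply: le_trans h.
have -> : dot_on f (op_on f) = dot_on f f - dir_on f by rewrite dir_onE; ring.
by rewrite -subr_ge0 (_ : _ - _ = dir_on f ^+ 2) ?sqr_ge0//; ring.
Qed.

(** Division-free form. By log-convexity the ratios of consecutive [a j] are nondecreasing, and the
    first is at least L / V; the induction carries positivity of [a j] in order to cancel it. *)
Lemma dot_on_iter_lower f t : 0 < dot_on f f - 2 * dir_on f ->
  (dot_on f f - 2 * dir_on f) ^+ t * dot_on f f
  <= dot_on (iter t op_on f) (iter t op_on f) * dot_on f f ^+ t.
Proof.
set V := dot_on f f; set L := V - _ => L0.
have V0 : 0 < V by apply: lt_le_trans L0 _; rewrite gerBl mulr_ge0 ?dir_on_ge0.
pose a j := dot_on (iter j op_on f) (iter j op_on f).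
have step j : 0 < a j /\ a j * L <= a j.+1 * V.
  elim: j => [|j [aj ih]].
    by split => //; rewrite mulrC ler_pM2r// dot_on_op_on_lower.
  have aj1 : 0 < a j.+1.
    by rewrite -(pmulr_lgt0 _ V0); apply: lt_le_trans ih; rewrite mulr_gt0.
  split => //.
  have lc : a j.+1 ^+ 2 <= a j * a j.+2.
    have -> : a j.+1 = dot_on (iter j op_on f) (iter j.+2 op_on f).
      by rewrite /a /= dot_on_op_on.
    exact: dot_on_CS.
  rewrite -(ler_pM2l aj).
  apply: le_trans (_ : a j.+1 * (a j.+1 * V) <= _).
    by rewrite mulrCA ler_pM2l.
  by rewrite !mulrA ler_pM2r.
elim: t => [|t ih]; first by rewrite !expr0 mul1r mulr1.
rewrite !exprS -mulrA.
apply: le_trans (_ : L * (a t * V ^+ t) <= _); first by rewrite ler_pM2l.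
rewrite !mulrA ler_pM2r ?exprn_gt0// mulrC.
exact: (step t).2.
Qed.

Lemma op_on_le f S : (forall x, x \in A -> `|f x| <= S) ->
  forall x, x \in A -> `|op_on f x| <= S.
Proof.
move=> fS x xA; apply: le_trans (ler_norm_sum _ _ _) _.
rewrite -[leRHS]mul1r -(K_sum1 _ xA) mulr_suml.
apply: ler_sum => y yA.
by rewrite normrM ger0_norm ?K_ge0// ler_wpM2l ?K_ge0// fS.
Qed.

(** * Upper bound on the iterates from contraction off a rare set *)

Variables (G : {set T}) (h : T -> T -> R) (kap : R).
Hypothesis kap01 : 0 <= kap <= 1.
Hypothesis h_ge0 : forall x y, 0 <= h x y.
Hypothesis h_ge1 : forall x y, x != y -> 1 <= h x y.
(* Wasserstein contraction from good pairs in the metric h, in a form where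
   the additive errors u are transported exactly by the two marginals. *)
Hypothesis contr : forall x y, x \in G -> y \in G ->
  forall (g u : T -> R) (a : R), 0 <= a ->
  (forall x' y', x' \in A -> y' \in A -> g x' - g y' <= a * h x' y' + u x' + u y') ->
  op_on g x - op_on g y <= a * (1 - kap) * h x y + op_on u x + op_on u y.

Definition bad_on (x : T) : R := (x \in A :\: G)%:R.

(* Expected number of visits to A \ G before time t. *)
Fixpoint visits (t : nat) : T -> R :=
  if t is t'.+1 then fun x => bad_on x + op_on (visits t') x else fun=> 0.

Lemma visits_ge0 t x : x \in A -> 0 <= visits t x.
Proof.
elim: t x => [|t ih] x xA //=.
rewrite addr_ge0 ?ler0n// sumr_ge0// => y yA.
by rewrite mulr_ge0 ?K_ge0 ?ih.
Qed.

(** By stationarity each of the t steps contributes the same mass. *)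
Lemma mean_visits t :
  \sum_(x in A) w x * visits t x = t%:R * \sum_(x in A :\: G) w x.
Proof.
elim: t => [|t ih] /=.
  by rewrite mul0r big1// => x _; rewrite mulr0.
under eq_bigr do rewrite mulrDr.
rewrite big_split /= dot_on_op_on1 ih -natr1 mulrDl mul1r addrC; congr (_ + _).
rewrite [RHS]big_mkcond [LHS]big_mkcond /=; apply: eq_bigr => x _.
rewrite /bad_on finset.in_setD.
by case: (x \in A); case: (x \in G); rewrite /= ?mulr0 ?mulr1.
Qed.

(** From two good points [contr] contracts the metric term and transports the visit counts. From a
    bad point, the visit counted at that moment alone pays for the trivial oscillation 2 S. *)
Lemma iter_op_on_osc f S t : 0 <= S -> (forall x, x \in A -> `|f x| <= S) ->
  forall x y, x \in A -> y \in A ->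
  iter t op_on f x - iter t op_on f y
  <= 2 * S * (1 - kap) ^+ t * h x y
     + 2 * S * visits t x + 2 * S * visits t y.
Proof.
move=> S0 fS; case/andP: kap01 => k0 k1.
have itS j : forall x, x \in A -> `|iter j op_on f x| <= S.
  by elim: j => [|j ih] //=; exact: op_on_le.
have osc j x y : x \in A -> y \in A -> iter j op_on f x - iter j op_on f y <= 2 * S.
  move=> /(itS j) + /(itS j); rewrite !ler_norml => /andP[_ ?] /andP[? _]; lra.
have S2 : 0 <= 2 * S by rewrite mulr_ge0.
elim: t => [|t ih] x y xA yA.
  rewrite /= !mulr0 !addr0 mulr1.
  have [->|/h_ge1 h1] := eqVneq x y; first by rewrite subrr mulr_ge0.
  apply: le_trans (osc 0%N _ _ xA yA) _; by rewrite ler_peMr.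
have bad1 z : z \in A -> z \notin G -> 1 <= visits t.+1 z.
  move=> zA zG; rewrite /= /bad_on finset.in_setD zA zG /= lerDl.
  by rewrite sumr_ge0// => z' zA'; rewrite mulr_ge0 ?K_ge0 ?visits_ge0.
have d0 : 0 <= 2 * S * (1 - kap) ^+ t.+1 * h x y.
  by rewrite !mulr_ge0 ?exprn_ge0 ?h_ge0// subr_ge0.
have vx := visits_ge0 t.+1 x xA; have vy := visits_ge0 t.+1 y yA.
have [xG|/(bad1 _ xA) v1] := boolP (x \in G); last first.
  apply: le_trans (osc _ _ _ xA yA) _; rewrite -[leLHS]addr0.
  by apply: lerD; [apply: ler_wpDl; rewrite ?ler_peMr|rewrite mulr_ge0].
have [yG|/(bad1 _ yA) v1] := boolP (y \in G); last first.
  apply: le_trans (osc _ _ _ xA yA) _; rewrite -[leLHS]add0r.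
  by apply: lerD; [rewrite addr_ge0// mulr_ge0|rewrite ler_peMr].
have a0 : 0 <= 2 * S * (1 - kap) ^+ t by rewrite mulr_ge0// exprn_ge0// subr_ge0.
have := contr _ _ xG yG (iter t op_on f) (fun z => 2 * S * visits t z) _ a0 ih.
move=> H; apply: le_trans H _.
have opZ z : op_on (fun z => 2 * S * visits t z) z = 2 * S * op_on (visits t) z.
  by rewrite /op_on mulr_sumr; apply: eq_bigr => y' _; rewrite mulrCA.
rewrite !opZ /= /bad_on !finset.in_setD xG yG /= !add0r exprSr -!mulrA.
by rewrite !lerD// -?mulrA.
Qed.

(** A centred g satisfies g x = sum_y w y (g x - g y), so averaging the oscillation bound over y
    bounds |g x| itself. *)
Lemma dot_on_iter_upper f S t H : 0 <= S -> (forall x, x \in A -> `|f x| <= S) ->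
  \sum_(x in A) w x * f x = 0 -> (forall x y, h x y <= H) ->
  dot_on (iter t op_on f) (iter t op_on f)
  <= 2 * S ^+ 2 * ((1 - kap) ^+ t * H + 2 * t%:R * \sum_(x in A :\: G) w x).
Proof.
move=> S0 fS f0 hH; case/andP: kap01 => k0 k1.
have S2 : 0 <= 2 * S by rewrite mulr_ge0.
set g := iter t op_on f.
have mv := mean_visits t.
move: (\sum_(x in A :\: G) w x) mv => b mv.
have g0 : \sum_(x in A) w x * g x = 0.
  by rewrite /g; elim: (t) => [|j ih] //=; rewrite dot_on_op_on1.
have gS x : x \in A -> `|g x| <= S.
  by rewrite /g; elim: (t) x => [|j ih] //=; exact: op_on_le.
have k1' : 0 <= (1 - kap) ^+ t by rewrite exprn_ge0// subr_ge0.
pose D x := 2 * S * ((1 - kap) ^+ t * H) + 2 * S * visits t x + 2 * S * (t%:R * b).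
have bnd x : x \in A -> `|g x| <= D x.
  move=> xA.
  have one : D x = \sum_(y in A) w y * (2 * S * ((1 - kap) ^+ t * H)
     + 2 * S * visits t x + 2 * S * visits t y).
    transitivity ((2 * S * ((1 - kap) ^+ t * H) + 2 * S * visits t x)
      * \sum_(y in A) w y + 2 * S * \sum_(y in A) w y * visits t y).
      by rewrite w_sum1 mv mulr1.
    rewrite !mulr_sumr -big_split /=; apply: eq_bigr => y yA; ring.
  have e : g x = \sum_(y in A) w y * (g x - g y).
    under eq_bigr do rewrite mulrBr.
    by rewrite sumrB g0 subr0 -mulr_suml w_sum1 mul1r.
  have e' : - g x = \sum_(y in A) w y * (g y - g x).
    under eq_bigr do rewrite mulrBr.
    by rewrite sumrB g0 sub0r -mulr_suml w_sum1 mul1r.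
  have hh y : 2 * S * (1 - kap) ^+ t * h x y <= 2 * S * ((1 - kap) ^+ t * H).
    by rewrite -mulrA ler_wpM2l// ler_wpM2l.
  have hh' y : 2 * S * (1 - kap) ^+ t * h y x <= 2 * S * ((1 - kap) ^+ t * H).
    by rewrite -mulrA ler_wpM2l// ler_wpM2l.
  rewrite ler_norml; apply/andP; split.
    rewrite lerNl e' one; apply: ler_sum => y yA; rewrite ler_wpM2l//.
    have := iter_op_on_osc f S t S0 fS y x yA xA.
    by rewrite -/g => H1; apply: le_trans H1 _; rewrite addrAC !lerD.
  rewrite e one; apply: ler_sum => y yA; rewrite ler_wpM2l//.
  have := iter_op_on_osc f S t S0 fS x y xA yA.
  by rewrite -/g => H1; apply: le_trans H1 _; rewrite !lerD.
(* Only one factor of g^2 is bounded by [D], the other by S: the mean of [visits] is available, not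
   its second moment. *)
apply: (@le_trans _ _ (\sum_(x in A) w x * (S * D x))).
  apply: ler_sum => x xA; rewrite ler_wpM2l// -expr2 -real_normK ?num_real//.
  by rewrite expr2 ler_pM ?gS ?bnd.
have -> : \sum_(x in A) w x * (S * D x)
  = (2 * S ^+ 2 * ((1 - kap) ^+ t * H) + 2 * S ^+ 2 * (t%:R * b)) * \sum_(x in A) w x
   + 2 * S ^+ 2 * \sum_(x in A) w x * visits t x.
  by rewrite !mulr_sumr -big_split /=; apply: eq_bigr => x xA; rewrite /D; ring.
rewrite w_sum1 mv.
by rewrite le_eqVlt; apply/orP; left; apply/eqP; ring.
Qed.

End ReversibleChain.

(** * Edges and swaps *)

Section EdgeCounts.
Variable n : nat.
Implicit Types e f s t : edge n.
Implicit Types x y : config n.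

Lemma card_edge : #|{: edge n}| = 'C(n, 2).
Proof.
rewrite card_sig -[in RHS](card_ord n) -card_draws -sum1_card -sum1_card.
by apply: eq_bigl => A; rewrite !inE.
Qed.

Lemma adjC e f : adj e f = adj f e.
Proof. by rewrite /adj eq_sym disjoint_sym. Qed.

Lemma adjxx e : adj e e = false.
Proof. by rewrite /adj eqxx. Qed.

(** Expresses adjacency through an intersection size, which splits into a sum over vertices and so
    allows double counting. *)
Lemma card_edgeI e f : #|val e :&: val f| = (adj f e + 2 * (f == e))%N.
Proof.
have ce := eqP (valP e); have cf := eqP (valP f).
rewrite /adj; have [->|fe] /= := eqVneq f e; first by rewrite finset.setIid.
rewrite muln0 addn0 disjoint_sym -setI_eq0 -cards_eq0.
have le2 : (#|val e :&: val f| <= 2)%N.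
  by rewrite (leq_trans (subset_leq_card (subsetIl _ _))) ?ce.
have ne2 : #|val e :&: val f| != 2%N.
  apply: contra fe => /eqP c2; apply/eqP/val_inj.
  have /eqP <- : val e :&: val f == val f.
    by rewrite eqEcard subsetIr cf c2.
  by apply/eqP; rewrite eqEcard subsetIl ce c2.
by case: (#|val e :&: val f|) le2 ne2 => [|[|[|m]]].
Qed.

Lemma card_edges_at (v : 'I_n) : #|[set f : edge n | v \in val f]| = n.-1.
Proof.
have -> : n.-1 = #|[set~ v]| by rewrite cardsC1 card_ord.
have P2 (w : 'I_n) : w \in [set~ v] -> #|[set v; w]| == 2%N.
  by rewrite !inE cards2 (eq_sym v) => ->.
(* The map w -> {v, w}; the option type accounts for w = v, which gives no edge. *)
pose g (w : 'I_n) : option (edge n) := insub [set v; w].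
have gE w : w \in [set~ v] -> omap val (g w) = Some [set v; w].
  by move=> /P2 h; rewrite /g insubT.
rewrite -(card_imset _ (@Some_inj _)).
rewrite -(@card_in_imset _ _ g) => [|w w' hw hw' ggE]; last first.
  have := gE w hw; rewrite ggE gE// => -[] /setP/(_ w').
  by rewrite !inE eqxx orbT; move: hw'; rewrite !inE => /negPf -> /= /esym/eqP.
apply: eq_card => o; apply/imsetP/imsetP => [[f]|[w hw ->]].
  rewrite inE => vf ->.
  have := cardsD1 v (val f); rewrite vf (eqP (valP f)) => -[/esym/eqP/cards1P[w fw]].
  have wv : w \in [set~ v].
    by have := set11 w; rewrite -fw !inE => /andP[].
  exists w => //; apply/esym.
  have : omap val (g w) = Some (val f).
    by rewrite gE//; congr Some; rewrite -(finset.setD1K vf) fw.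
  by case: (g w) => //= f' [] /val_inj ->.
have := gE w hw; case: (g w) => //= f -[fE]; exists f => //.
by rewrite inE fE !inE eqxx.
Qed.

Lemma sum_edges_at (P : edge n -> bool) (v : 'I_n) :
  #|[set f : edge n | P f & v \in val f]| = (\sum_f P f * (v \in val f))%N.
Proof.
rewrite -sum1_card big_mkcond /=; apply: eq_bigr => f _.
by rewrite inE; case: (P f); case: (v \in _).
Qed.

Lemma cardI_sum e f :
  #|val e :&: val f| = (\sum_v (v \in val e) * (v \in val f))%N.
Proof.
rewrite -sum1_card big_mkcond /=; apply: eq_bigr => v _.
by rewrite inE; case: (v \in val e); case: (v \in val f).
Qed.

(** Summing |e :&: f| over f counts the n - 1 edges at each endpoint of e; the edge e itself has
    weight 2. *)
Lemma sum_adj e : (\sum_f adj f e + 2 = 2 * n.-1)%N.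
Proof.
have -> : (2 * n.-1 = \sum_(f : edge n) #|val e :&: val f|)%N.
  under eq_bigr do rewrite cardI_sum.
  transitivity (#|val e| * n.-1)%N; first by rewrite (eqP (valP e)).
  rewrite exchange_big /= -sum1_card big_distrl /= big_mkcond /=.
  apply: eq_bigr => v _; rewrite -big_distrr /=.
  have := sum_edges_at (fun=> true) v; rewrite [LHS]card_edges_at => ->.
  case: (v \in _); rewrite ?mul0n// !mul1n.
  by apply: eq_bigr => f _; rewrite mul1n.
under [RHS]eq_bigr do rewrite card_edgeI.
rewrite big_split /= -big_distrr /=; congr (_ + _)%N.
by rewrite (bigD1 e)//= eqxx big1 => [|f /negPf ->].
Qed.

Lemma dcountE e x : dcount e x = (\sum_f x f * adj f e)%N.
Proof.
rewrite /dcount -sum1_card big_mkcond /=; apply: eq_bigr => f _.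
by rewrite inE; case: (x f); case: (adj f e).
Qed.

Lemma degE x v : deg x v = (\sum_e x e * (v \in val e))%N.
Proof. exact: sum_edges_at. Qed.

Lemma bin2_sqr d : (2 * 'C(d, 2) + d = d * d)%N.
Proof. by rewrite -(mul_bin_diag d 1) bin1; case: d => // d; rewrite /= addnC -mulnS. Qed.

(** Both sides count ordered pairs of adjacent occupied edges. The sum of squared degrees also
    counts each occupied edge paired with itself, once per endpoint; [bin2_sqr] removes this
    diagonal. *)
Lemma two_star_sum x :
  (2 * \sum_(v < n) 'C(deg x v, 2) = \sum_e x e * dcount e x)%N.
Proof.
have h1 : (\sum_v deg x v = 2 * \sum_e x e)%N.
  under eq_bigr do rewrite degE.
  rewrite exchange_big /= big_distrr /=; apply: eq_bigr => e _.
  rewrite -big_distrr /= mulnC; congr (_ * _)%N.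
  transitivity #|val e|; last by rewrite (eqP (valP e)).
  rewrite -sum1_card [RHS]big_mkcond.
  by apply: eq_bigr => v _; case: (v \in _).
have h2 : (\sum_v deg x v * deg x v
   = \sum_e \sum_f x e * x f * #|val e :&: val f|)%N.
  transitivity (\sum_v \sum_e \sum_f
      x e * x f * ((v \in val e) * (v \in val f)))%N.
    apply: eq_bigr => v _; rewrite degE big_distrl /=; apply: eq_bigr => e _.
    by rewrite big_distrr /=; apply: eq_bigr => f _; rewrite mulnACA.
  rewrite exchange_big /=; apply: eq_bigr => e _.
  rewrite exchange_big /=; apply: eq_bigr => f _.
  by rewrite -big_distrr /= cardI_sum.
have h3 : (\sum_e \sum_f x e * x f * #|val e :&: val f|
   = \sum_e x e * dcount e x + 2 * \sum_e x e)%N.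
  rewrite big_distrr -big_split /=; apply: eq_bigr => e _.
  rewrite dcountE big_distrr /=.
  under eq_bigr do rewrite card_edgeI mulnDr.
  rewrite big_split /=; congr (_ + _)%N.
    by apply: eq_bigr => f _; rewrite mulnA.
  rewrite (bigD1 e)//= eqxx big1 ?addn0 => [|f /negPf ->]; last by rewrite !muln0.
  by case: (x e).
apply/eqP; rewrite -(eqn_add2r (2 * \sum_e x e)) -h3 -h2 -{1}h1.
rewrite big_distrr -big_split /=; apply/eqP/eq_bigr => v _.
exact: bin2_sqr.
Qed.

(** * Algebra of a single swap *)

Lemma swapE x s t e : x s -> ~~ x t ->
  swap x s t e = (x e && (e != s)) || (e == t).
Proof.
move=> xs xt; rewrite ffunE; case: eqP => [->|_]; last first.
  by case: eqP; rewrite ?orbT ?andbT ?orbF.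
by rewrite andbF; apply/esym/negbTE/eqP => st; rewrite -st xs in xt.
Qed.

Lemma swap_neq x s t : x s -> ~~ x t -> s != t.
Proof. by move=> xs; apply: contraNneq => <-. Qed.

Lemma swapL x s t : swap x s t s = false.
Proof. by rewrite ffunE eqxx. Qed.

Lemma swapR x s t : x s -> ~~ x t -> swap x s t t.
Proof. by move=> xs xt; rewrite swapE// eqxx orbT. Qed.

Lemma swap_out x s t e : e != s -> e != t -> swap x s t e = x e.
Proof. by move=> /negPf es /negPf et; rewrite ffunE es et. Qed.

Lemma swapK x s t : x s -> ~~ x t -> swap (swap x s t) t s = x.
Proof.
move=> xs xt; have st := swap_neq _ _ _ xs xt.
apply/ffunP => e; rewrite ffunE; case: eqP => [->|/eqP et].
  by rewrite (negbTE xt).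
by case: eqP => [->|/eqP es]; rewrite ?swap_out.
Qed.

Lemma swap_inj x s t s' t' : x s -> ~~ x t -> x s' -> ~~ x t' ->
  swap x s t = swap x s' t' -> (s, t) = (s', t').
Proof.
move=> xs xt xs' xt' E.
have := swapL x s' t'; rewrite -E swapE// xs' /= => /norP[/negPn/eqP <- _].
have := swapR x s' t' xs' xt'; rewrite -E swapE// (negbTE xt') /= => /eqP <-.
by [].
Qed.

(** Serves every edgewise additive functional: the number of edges, [rd], [hd], and the energy,
    where F itself depends on s and t. *)
Lemma sum_swap (V : comNzRingType) x s t (F : edge n -> bool -> V) :
  x s -> ~~ x t ->
  \sum_e F e (swap x s t e) + F s true + F t false
  = \sum_e F e (x e) + F s false + F t true.
Proof.
move=> xs xt; have st := swap_neq _ _ _ xs xt.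
rewrite (bigD1 s)//= (bigD1 t)/=; last by rewrite eq_sym.
rewrite [in RHS](bigD1 s)//= [in RHS](bigD1 t)/=; last by rewrite eq_sym.
rewrite swapL swapR// xs (negbTE xt).
rewrite (eq_bigr (fun e => F e (x e))); last first.
  by move=> e /andP[es et]; rewrite swap_out.
ring.
Qed.

End EdgeCounts.

(** * The Kawasaki kernel as a sum over swaps *)

Section KawasakiKernel.
Variables (R : realType) (n k : nat) (beta : R).
Implicit Types e f s t : edge n.
Implicit Types x y : config n.

Definition rd e x : R := (dcount e x)%:R.

Lemma rdE e x : rd e x = \sum_f (x f)%:R * (adj f e)%:R.
Proof. by rewrite /rd dcountE natr_sum; apply: eq_bigr => f _; rewrite natrM. Qed.

Lemma rd_swap e x s t : x s -> ~~ x t ->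
  rd e (swap x s t) = rd e x - (adj s e)%:R + (adj t e)%:R.
Proof.
move=> xs xt; have := @sum_swap n R x s t (fun f b => b%:R * (adj f e)%:R) xs xt.
by rewrite -!rdE !mul1r !mul0r; lra.
Qed.

Lemma HamE x : Ham beta x = beta / n%:R * \sum_e (x e)%:R * rd e x.
Proof.
have -> : \sum_e (x e)%:R * rd e x = 2 * \sum_(v < n) 'C(deg x v, 2)%:R.
  rewrite -natr_sum -natrM two_star_sum natr_sum.
  by apply: eq_bigr => e _; rewrite natrM.
by rewrite /Ham; ring.
Qed.

(** The term in [adj s t] is there because [rd t x] still counts s, which is gone when t is
    added. *)
Lemma sum_rd_swap x s t : x s -> ~~ x t ->
  \sum_e (swap x s t e)%:R * rd e (swap x s t)
  = \sum_e (x e)%:R * rd e x + 2 * (rd t x - rd s x - (adj s t)%:R).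
Proof.
move=> xs xt.
under eq_bigr do rewrite rd_swap//.
have := @sum_swap n R x s t
  (fun e b => b%:R * (rd e x - (adj s e)%:R + (adj t e)%:R)) xs xt.
rewrite /= !mul1r !mul0r !addr0 !adjxx.
have -> : \sum_e (x e)%:R * (rd e x - (adj s e)%:R + (adj t e)%:R)
  = \sum_e (x e)%:R * rd e x - rd s x + rd t x.
  rewrite !rdE -sumrB -big_split /=; apply: eq_bigr => e _.
  by rewrite (adjC _ e s) (adjC _ e t); ring.
rewrite (adjC _ t s) /= ?mulr0n; lra.
Qed.

(** The ratio mu y / (mu x + mu y) for y = [swap x s t] (see [P_off_swap]), in a form that shows its
    Lipschitz dependence on the local counts. *)
Definition acc x s t : R :=
  logistic (2 * beta / n%:R * (rd t x - rd s x - (adj s t)%:R)).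

Lemma Ham_swap x s t : x s -> ~~ x t ->
  Ham beta (swap x s t) - Ham beta x
  = 2 * beta / n%:R * (rd t x - rd s x - (adj s t)%:R).
Proof. by move=> xs xt; rewrite !HamE sum_rd_swap//; ring. Qed.

Lemma acc_gt0 x s t : 0 < acc x s t. Proof. exact: logistic_gt0. Qed.
Lemma acc_le1 x s t : acc x s t <= 1. Proof. exact: logistic_le1. Qed.

Local Notation N := (nedges n).

Lemma OmegaE x : (x \in Omega n k) = ((\sum_e x e)%N == k).
Proof. by rewrite inE. Qed.

Lemma sum_occ x : x \in Omega n k -> \sum_e (x e)%:R = k%:R :> R.
Proof. by rewrite OmegaE => /eqP <-; rewrite natr_sum. Qed.

Lemma sum_emp x : x \in Omega n k ->
  \sum_e (~~ x e)%:R = N%:R - k%:R :> R.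
Proof.
move=> xO; rewrite -(sum_occ x xO) /nedges -card_edge.
have -> : #|{: edge n}|%:R = \sum_(e : edge n) 1 :> R by rewrite sumr_const.
by rewrite -sumrB; apply: eq_bigr => e _; case: (x e); rewrite ?subrr ?subr0.
Qed.

Lemma swap_Omega x s t : x s -> ~~ x t ->
  (swap x s t \in Omega n k) = (x \in Omega n k).
Proof.
move=> xs xt; rewrite !OmegaE; congr (_ == _).
apply/eqP; rewrite -(eqr_nat R) !natr_sum; apply/eqP.
by have := @sum_swap n R x s t (fun e b => b%:R) xs xt; lra.
Qed.

Lemma is_swapP x y :
  reflect (exists p : edge n * edge n, [/\ x p.1, ~~ x p.2 & y = swap x p.1 p.2])
    (is_swap x y).
Proof.
apply: (iffP existsP) => [[s /existsP[t /and3P[xs xt /eqP ->]]]|[[s t] /= [xs xt ->]]].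
  by exists (s, t).
by exists s; apply/existsP; exists t; rewrite xs xt eqxx.
Qed.

Lemma is_swap_sym x y : is_swap x y = is_swap y x.
Proof.
wlog suff H : x y / is_swap x y -> is_swap y x.
  by apply/idP/idP; apply: H.
move=> /is_swapP[[s t] /= [xs xt ->]]; apply/is_swapP; exists (t, s) => /=.
by rewrite swapR// swapL swapK.
Qed.

Lemma is_swapxx x : is_swap x x = false.
Proof.
apply/is_swapP => -[[s t] /= [xs xt E]].
by have := swapL _ x s t; rewrite -E xs.
Qed.

Lemma Z_gt0 x : x \in Omega n k ->
  0 < \sum_(Y in Omega n k) expR (Ham beta Y).
Proof.
move=> xO; rewrite (bigD1 x)//= ltr_pwDl ?expR_gt0// sumr_ge0// => y _.
exact: expR_ge0.
Qed.

Lemma mu_ge0 x : 0 <= mu k beta x.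
Proof.
rewrite /mu; case: ifP => // xO.
by rewrite divr_ge0 ?expR_ge0// ltW// (Z_gt0 _ xO).
Qed.

Lemma mu_gt0 x : x \in Omega n k -> 0 < mu k beta x.
Proof. by move=> xO; rewrite /mu xO divr_gt0 ?expR_gt0// (Z_gt0 _ xO). Qed.

Lemma P_off_ge0 x y : (k <= N)%N -> 0 <= P_offdiag k beta x y.
Proof.
move=> kN; rewrite /P_offdiag; case: ifP => // _.
apply: mulr_ge0; first by rewrite invr_ge0 mulr_ge0 ?subr_ge0 ?ler_nat.
by rewrite divr_ge0 ?addr_ge0 ?mu_ge0.
Qed.

Lemma P_off_rev x y :
  mu k beta x * P_offdiag k beta x y = mu k beta y * P_offdiag k beta y x.
Proof.
rewrite /P_offdiag is_swap_sym; case: ifP; rewrite ?mulr0// => _.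
by rewrite [in RHS](addrC (mu _ _ y)); ring.
Qed.

Lemma P_off_swap x s t : x \in Omega n k -> x s -> ~~ x t ->
  P_offdiag k beta x (swap x s t)
  = (k%:R * (N%:R - k%:R))^-1 * acc x s t.
Proof.
move=> xO xs xt; rewrite /P_offdiag.
have -> : is_swap x (swap x s t) by apply/is_swapP; exists (s, t).
congr (_ * _); rewrite /mu swap_Omega// xO /acc /logistic -Ham_swap//.
have Z0 := Z_gt0 _ xO; move: (\sum_(_ in _) _) Z0 => Z Z0.
have hx := expR_gt0 (Ham beta x); have hy := expR_gt0 (Ham beta (swap x s t)).
rewrite opprB expRD expRN.
by field; rewrite !gt_eqF ?addr_gt0.
Qed.

(** A neighbour of x determines the pair (s, t), by [swap_inj]. The later estimates live on such
    pairs, where the coupling acts. *)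
Lemma sum_P_off x (A : {set config n}) (F : config n -> R) :
  x \in Omega n k ->
  \sum_(y in A) P_offdiag k beta x y * F y
  = (k%:R * (N%:R - k%:R))^-1 *
    \sum_(s | x s) \sum_(t | ~~ x t) acc x s t *
      ((swap x s t \in A)%:R * F (swap x s t)).
Proof.
move=> xO; rewrite pair_big_dep /= mulr_sumr.
pose D := [set p : edge n * edge n | x p.1 && ~~ x p.2].
have injD : {in D &, injective (fun p => swap x p.1 p.2)}.
  move=> [s t] [s' t']; rewrite !inE /= => /andP[xs xt] /andP[xs' xt'].
  exact: swap_inj.
transitivity (\sum_(y in [set swap x p.1 p.2 | p in D])
     P_offdiag k beta x y * ((y \in A)%:R * F y)).
  rewrite [LHS]big_mkcond [RHS]big_mkcond /=; apply: eq_bigr => y _.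
  have -> : (y \in [set swap x p.1 p.2 | p in D]) = is_swap x y.
    apply/imsetP/is_swapP => [[p]|[p [xs xt ->]]].
      by rewrite inE => /andP[xs xt] ->; exists p.
    by exists p; rewrite // inE xs.
  rewrite /P_offdiag; case: (is_swap x y); case: (y \in A);
  by rewrite ?mul0r ?mul1r ?mulr0.
rewrite big_imset//=; apply: eq_big => [p|p]; first by rewrite inE.
by rewrite inE => /andP[xs xt]; rewrite P_off_swap// -[LHS]mulrA.
Qed.

Lemma sum_pairs_const x (c : R) : x \in Omega n k ->
  \sum_(s | x s) \sum_(t | ~~ x t) c = k%:R * (N%:R - k%:R) * c.
Proof.
move=> xO; rewrite -{1}(sum_occ x xO) -(sum_emp x xO).
rewrite -mulrA mulr_suml big_mkcond; apply: eq_bigr => s _.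
case: (x s); rewrite ?mul0r// mul1r mulr_suml [LHS]big_mkcond.
by apply: eq_bigr => t _; case: (x t); rewrite ?mul0r ?mul1r.
Qed.

Lemma sum_pairs_l x (F : edge n -> R) : x \in Omega n k ->
  \sum_(s | x s) \sum_(t | ~~ x t) F s = (N%:R - k%:R) * \sum_(s | x s) F s.
Proof.
move=> xO; rewrite mulr_sumr; apply: eq_bigr => s _.
rewrite -(sum_emp x xO) mulr_suml big_mkcond.
by apply: eq_bigr => t _; case: (x t); rewrite ?mul0r ?mul1r.
Qed.

Lemma sum_pairs_r x (F : edge n -> R) : x \in Omega n k ->
  \sum_(s | x s) \sum_(t | ~~ x t) F t = k%:R * \sum_(t | ~~ x t) F t.
Proof.
move=> xO; rewrite -(sum_occ x xO) mulr_suml big_mkcond.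
by apply: eq_bigr => s _; case: (x s); rewrite ?mul0r ?mul1r.
Qed.

Lemma sum_occ_adj x e : \sum_(s | x s) (adj s e)%:R = rd e x.
Proof.
rewrite rdE big_mkcond; apply: eq_bigr => s _.
by case: (x s); rewrite ?mul0r ?mul1r.
Qed.

Lemma sum_emp_adj x e : (1 < n)%N ->
  \sum_(t | ~~ x t) (adj t e)%:R = 2 * (n%:R - 2) - rd e x.
Proof.
move=> n1; have := sum_adj _ e => /(congr1 (fun m => m%:R : R)).
rewrite natrD natrM natr_sum -subn1 natrB; last by rewrite ltnW.
rewrite (bigID (fun f => x f))/= => h.
by rewrite -sum_occ_adj; lra.
Qed.

(** Equal local counts would give 1/2 up to the adjacency term, which is the + 1. *)
Lemma acc_half x s t M : 0 <= beta -> (0 < n)%N ->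
  `|rd t x - rd s x| <= 2 * M ->
  `|acc x s t - 2^-1| <= beta / (2 * n%:R) * (2 * M + 1).
Proof.
move=> b0 n0 hM; rewrite -logistic0; apply: le_trans (logistic_lip _ _ _) _.
have n0R : 0 < n%:R :> R by rewrite ltr0n.
rewrite subr0 normrM (@ger0_norm _ (2 * beta / n%:R)); last first.
  by rewrite divr_ge0 ?mulr_ge0// ltW.
have -> : beta / (2 * n%:R) * (2 * M + 1)
  = 4^-1 * (2 * beta / n%:R * (2 * M + 1)) by field; rewrite gt_eqF.
rewrite !ler_wpM2l ?divr_ge0 ?mulr_ge0 ?invr_ge0 ?(ltW n0R)//.
apply: le_trans (ler_normB _ _) _; apply: lerD => //.
by case: (adj s t); rewrite ?normr0 ?normr1.
Qed.

End KawasakiKernel.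

(** * Coupling *)

Lemma matching_involution (T : finType) (A B : {set T}) :
  #|A| = #|B| -> [disjoint A & B] ->
  exists tau : T -> T, [/\ involutive tau, forall e, e \in A -> tau e \in B,
    forall e, e \in B -> tau e \in A
    & forall e, e \notin A -> e \notin B -> tau e = e].
Proof.
move=> cAB dAB.
(* Sends the i-th element of C to the i-th element of D; for e in C and |C| = |D| the default of
   [nth] is never reached. *)
pose m (C D : {set T}) e := nth e (enum D) (index e (enum C)).
have mP (C D : {set T}) e : #|C| = #|D| -> e \in C ->
    m C D e \in D /\ m D C (m C D e) = e.
  move=> cCD eC.
  have i1 : (index e (enum C) < size (enum D))%N.
    by rewrite -cardE -cCD cardE index_mem mem_enum.
  have mD : m C D e \in D by rewrite -mem_enum mem_nth.
  split => //; rewrite /m index_uniq ?enum_uniq//.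
  by apply/nth_index; rewrite mem_enum.
have AB e : e \in A -> e \notin B.
  by move=> eA; apply/negP => eB; move/pred0P: dAB => /(_ e) /=; rewrite eA eB.
exists (fun e => if e \in A then m A B e else if e \in B then m B A e else e).
split => [e|e eA|e eB|e /negPf -> /negPf -> //].
- have [eA|eA] := boolP (e \in A).
    have [h1 h2] := mP A B e cAB eA.
    by rewrite ifN ?h1//; apply: contraL h1 => /AB.
  have [eB|eB] := boolP (e \in B); last by rewrite (negbTE eA) (negbTE eB).
  by have [h1 h2] := mP B A e (esym cAB) eB; rewrite h1.
- by rewrite eA; have [] := mP A B e cAB eA.
- rewrite ifN; first by rewrite eB; have [] := mP B A e (esym cAB) eB.
  by apply: contraL eB => /AB.
Qed.

Section Coupling.
Variables (R : realType) (n k : nat) (beta : R).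
Implicit Types e f s t : edge n.
Implicit Types x y : config n.
Local Notation N := (nedges n).

Definition hd x y : R := \sum_e (x e != y e)%:R.

Lemma hdC x y : hd x y = hd y x.
Proof. by apply: eq_bigr => e _; rewrite eq_sym. Qed.

Lemma hd_ge0 x y : 0 <= hd x y.
Proof. by apply: sumr_ge0 => e _; exact: ler0n. Qed.

Lemma hd_ge1 x y : x != y -> 1 <= hd x y.
Proof.
move=> xy; have /existsP[e he] : [exists e, x e != y e].
  apply: contraNT xy; rewrite negb_exists => /forallP h.
  by apply/eqP/ffunP => e; apply/eqP; have := h e; rewrite negbK.
rewrite /hd (bigD1 e)//= he lerDl sumr_ge0// => f _; exact: ler0n.
Qed.

Lemma hd_le x y : hd x y <= N%:R.
Proof.
rewrite /nedges -card_edge -sum1_card natr_sum.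
by apply: ler_sum => e _; case: (_ != _).
Qed.

Lemma hd_swap x y s t : x s -> ~~ x t ->
  hd (swap x s t) y = hd x y + 2 - 2 * (x s != y s)%:R - 2 * (x t != y t)%:R.
Proof.
move=> xs xt; have := @sum_swap n R x s t (fun e b => (b != y e)%:R) xs xt.
rewrite -!/(hd _ _) xs (negbTE xt) /=.
by case: (y s); case: (y t); rewrite /= ?mulr0n ?mulr1n; lra.
Qed.

(** x \ y and y \ x have the same size because x and y both have k edges. *)
Lemma exists_matching x y : x \in Omega n k -> y \in Omega n k ->
  exists tau : edge n -> edge n, [/\ involutive tau,
    forall e, y (tau e) = x e & forall e, x e = y e -> tau e = e].
Proof.
move=> xO yO.
pose A := [set e | x e && ~~ y e]; pose B := [set e | y e && ~~ x e].
have cAB : #|A| = #|B|.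
  have cE (z z' : config n) : (#|[set e | z e && ~~ z' e]| + \sum_e (z e && z' e)
      = \sum_e z e)%N.
    rewrite -sum1_card big_mkcond -big_split /=; apply: eq_bigr => e _.
    by rewrite inE; case: (z e); case: (z' e).
  apply/eqP; rewrite -(eqn_add2r (\sum_e (x e && y e))) cE.
  have -> : (\sum_e (x e && y e) = \sum_e (y e && x e))%N.
    by apply: eq_bigr => e _; rewrite andbC.
  by rewrite cE; move: xO yO; rewrite !inE => /eqP -> /eqP ->.
have dAB : [disjoint A & B].
  apply/pred0P => e /=; rewrite !inE; by case: (x e); case: (y e).
have [tau [tau2 tA tB tid]] := matching_involution _ A B cAB dAB.
exists tau; split => // e.
  case: (boolP (e \in A)) => [eA|eA].
    have := tA e eA; rewrite inE => /andP[-> _].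
    by move: eA; rewrite inE => /andP[->].
  case: (boolP (e \in B)) => [eB|eB].
    have := tB e eB; rewrite inE => /andP[_ /negbTE ->].
    by move: eB; rewrite inE => /andP[_ /negbTE ->].
  by rewrite tid//; move: eA eB; rewrite !inE; case: (x e); case: (y e).
by move=> xy; rewrite tid// !inE xy andbN.
Qed.

(** * Matched proposals and their expected cost *)

Section Matched.
Variables (x y : config n) (tau : edge n -> edge n).
Hypothesis tauK : involutive tau.
Hypothesis y_tau : forall e, y (tau e) = x e.
Hypothesis tau_id : forall e, x e = y e -> tau e = e.

Lemma x_tau e : x (tau e) = y e.
Proof. by rewrite -y_tau tauK. Qed.

(** A joint move through a disagreement e heals both e and [tau e], hence each - 2. The exception is
    t = tau s: the copies then exchange s and t and still disagree on both, and the + 4 restores the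
    distance. *)
Lemma hd_matched s t : x s -> ~~ x t ->
  [/\ hd x (swap y (tau s) (tau t))
      = hd x y + 2 - 2 * (x s != y s)%:R - 2 * (x t != y t)%:R
   & hd (swap x s t) (swap y (tau s) (tau t))
      = hd x y - 2 * (x s != y s)%:R - 2 * (x t != y t)%:R
        + 4 * (t == tau s)%:R].
Proof.
move=> xs xt.
have ys' : y (tau s) by rewrite y_tau.
have yt' : ~~ y (tau t) by rewrite y_tau.
have h1 : hd x (swap y (tau s) (tau t))
      = hd x y + 2 - 2 * (x s != y s)%:R - 2 * (x t != y t)%:R.
  by rewrite hdC hd_swap// hdC !x_tau !y_tau.
split; first exact: h1.
rewrite hd_swap// h1 !swapE// xs (negbTE xt) /=.
have st : s != t by apply: swap_neq xs xt.
have tse : (s == tau t) = (t == tau s).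
  by apply/eqP/eqP => ->; rewrite tauK.
rewrite tse.
have [ysE|ysE] := boolP (y s).
  have tsE : tau s = s by apply: tau_id; rewrite xs ysE.
  have -> : (t == tau s) = false by rewrite tsE eq_sym (negbTE st).
  rewrite tsE eqxx /=.
  have [ytE|ytE] := boolP (y t).
    by rewrite ?eqxx ?eqb_id ?eqbF_neg /= ?mulr0n ?mulr1n; lra.
  have -> : t == tau t by rewrite tau_id// (negbTE xt) (negbTE ytE).
  by rewrite ?eqxx ?eqb_id ?eqbF_neg /= ?mulr0n ?mulr1n; lra.
have [ytE|ytE] := boolP (y t).
  have -> : (t == tau t) = false.
    by apply/eqP => tt; move: yt'; rewrite -tt ytE.
  by case: (t == tau s); rewrite ?eqxx ?eqb_id ?eqbF_neg /= ?mulr0n ?mulr1n; lra.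
have -> : (t == tau s) = false.
  by apply/eqP => tt; move: ys'; rewrite -tt (negbTE ytE).
have -> : t == tau t by rewrite tau_id// (negbTE xt) (negbTE ytE).
by rewrite ?eqxx ?eqb_id ?eqbF_neg /= ?mulr0n ?mulr1n; lra.
Qed.

Lemma sum_pairs_matched (F : edge n -> edge n -> R) :
  \sum_(s | y s) \sum_(t | ~~ y t) F s t
  = \sum_(s | x s) \sum_(t | ~~ x t) F (tau s) (tau t).
Proof.
rewrite (reindex_inj (inv_inj tauK)) /=; apply: eq_big => [s|s _].
  by rewrite y_tau.
rewrite (reindex_inj (inv_inj tauK)) /=; apply: eq_bigl => t.
by rewrite y_tau.
Qed.

(* Expected Hamming distance after a matched pair of proposals, accepted with
   probabilities a and b using a common uniform variable. *)
Definition pair_cost (a b : R) s t : R :=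
  Num.min a b * hd (swap x s t) (swap y (tau s) (tau t))
  + (a - Num.min a b) * hd (swap x s t) y
  + (b - Num.min a b) * hd x (swap y (tau s) (tau t))
  + (1 - Num.max a b) * hd x y.

(** A move made by one copy only raises the distance, by 2, only if s and t are both agreements;
    touching a disagreement compensates. The last bracket is nonpositive, so the joint acceptance
    can be lowered to [al]. *)
Lemma pair_cost_le (al a b : R) s t : x s -> ~~ x t -> al <= a -> al <= b ->
  pair_cost a b s t <= hd x y
    + 2 * (`|a - b| * ((x s == y s) && (x t == y t))%:R)
    + al * (4 * (t == tau s)%:R - 2 * (x s != y s)%:R - 2 * (x t != y t)%:R).
Proof.
move=> xs xt ala alb; rewrite /pair_cost.
have [-> ->] := hd_matched s t xs xt; rewrite hd_swap//.
set is_ := (x s != y s); set it := (x t != y t).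
have [d d1] : exists d : R, (t == tau s)%:R = d by eexists.
have neg : 4 * (t == tau s)%:R - 2 * is_%:R - 2 * it%:R <= 0 :> R.
  have [tE|] := eqVneq t (tau s); last first.
    by move=> _; case: is_; case: it; rewrite /= ?mulr0n ?mulr1n; lra.
  have -> : is_.
    rewrite /is_; apply: contraNneq xt => /tau_id.
    by rewrite tE => ->.
  have -> : it by rewrite /it tE x_tau y_tau xs /is_ -x_tau -tE (negbTE xt).
  by rewrite /= ?mulr1n; lra.
rewrite -/is_ -/it.
have -> : ((x s == y s) && (x t == y t)) = ~~ is_ && ~~ it.
  by rewrite /is_ /it !negbK.
move: neg; move: (hd x y) => h; move: ((t == tau s)%:R) => dl neg.
have [ab|ab] := leP a b.
  rewrite ler0_norm ?subr_le0//.
  have := ler_wnM2r neg ala.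
  move: neg; case: is_; case: it; rewrite /= ?mulr0n ?mulr1n => neg H; nra.
rewrite gtr0_norm ?subr_gt0//.
have := ler_wnM2r neg alb.
move: neg; case: is_; case: it; rewrite /= ?mulr0n ?mulr1n => neg H; nra.
Qed.

(** The four hypotheses are averaged with the weights of the coupling: both copies accept, only x,
    only y, neither. *)
Lemma pair_transport (g1 g2 : config n -> R) (c a b : R) s t :
  0 <= a <= 1 -> 0 <= b <= 1 ->
  let x' := swap x s t in let y' := swap y (tau s) (tau t) in
  g1 x' - g2 y' <= c * hd x' y' -> g1 x' - g2 y <= c * hd x' y ->
  g1 x - g2 y' <= c * hd x y' -> g1 x - g2 y <= c * hd x y ->
  (g1 x + a * (g1 x' - g1 x)) - (g2 y + b * (g2 y' - g2 y))
  <= c * pair_cost a b s t.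
Proof.
move=> /andP[a0 a1] /andP[b0 b1] x' y' h1 h2 h3 h4; rewrite /pair_cost -/x' -/y'.
have [ab|/ltW ab] := leP a b.
  have := ler_wpM2l a0 h1.
  have := ler_wpM2l (_ : 0 <= b - a) h3; rewrite subr_ge0 => /(_ ab).
  have := ler_wpM2l (_ : 0 <= 1 - b) h4; rewrite subr_ge0 => /(_ b1).
  by lra.
have := ler_wpM2l b0 h1.
have := ler_wpM2l (_ : 0 <= a - b) h2; rewrite subr_ge0 => /(_ ab).
have := ler_wpM2l (_ : 0 <= 1 - a) h4; rewrite subr_ge0 => /(_ a1).
by lra.
Qed.

Hypotheses (xO : x \in Omega n k) (yO : y \in Omega n k).

(** With equally many edges in x and y, half of the disagreements are occupied in x. *)
Lemma sum_diff_occ : \sum_(s | x s) (x s != y s)%:R = hd x y / 2 :> R.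
Proof.
have e1 : \sum_(s | x s) (x s != y s)%:R + \sum_(t | ~~ x t) (x t != y t)%:R
   = hd x y :> R by rewrite /hd [RHS](bigID (fun e => x e)).
have e2 : \sum_(s | x s) (x s != y s)%:R - \sum_(t | ~~ x t) (x t != y t)%:R
   = \sum_e (x e)%:R - \sum_e (y e)%:R :> R.
  rewrite [X in X - _]big_mkcond [X in _ - X]big_mkcond -!sumrB /=.
  apply: eq_bigr => e _.
  by case: (x e); case: (y e); rewrite /= ?subrr ?subr0 ?sub0r.
move: e2; rewrite !(sum_occ R n k)// subrr; lra.
Qed.

Lemma sum_diff_emp : \sum_(t | ~~ x t) (x t != y t)%:R = hd x y / 2 :> R.
Proof.
have e1 : \sum_(s | x s) (x s != y s)%:R + \sum_(t | ~~ x t) (x t != y t)%:R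
   = hd x y :> R by rewrite /hd [RHS](bigID (fun e => x e)).
move: e1; rewrite sum_diff_occ; lra.
Qed.

Lemma sum_matched_pairs :
  \sum_(s | x s) \sum_(t | ~~ x t) (t == tau s)%:R <= hd x y / 2 :> R.
Proof.
rewrite -sum_diff_occ; apply: ler_sum => s xs.
rewrite xs; have [ys|ys] /= := boolP (y s).
  rewrite big1// => t xt; case: eqP => // tE.
  by move: xt; rewrite tE x_tau ys.
rewrite (bigD1 (tau s)) ?x_tau//= eqxx big1 ?addr0// => t /andP[_ /negPf ->].
by [].
Qed.

Definition rdiff e : R := \sum_f (adj f e)%:R * (x f != y f)%:R.

Lemma rd_diff e : `|rd R n e x - rd R n e y| <= rdiff e.
Proof.
rewrite !rdE -sumrB; apply: le_trans (ler_norm_sum _ _ _) _.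
apply: ler_sum => f _; rewrite -mulrBl normrM mulrC.
rewrite (ger0_norm (ler0n _ _)) ler_wpM2l//.
by case: (x f); case: (y f); rewrite /= ?subrr ?subr0 ?sub0r ?normr0 ?normrN ?normr1.
Qed.

(** After exchanging sums, each disagreement f is weighted by its number of occupied neighbours. *)
Lemma rdiff_occ (B : R) : (forall f, rd R n f x <= B) ->
  \sum_(s | x s) rdiff s <= B * hd x y.
Proof.
move=> hB; rewrite exchange_big /= mulr_sumr; apply: ler_sum => f _.
rewrite -mulr_suml ler_wpM2r//.
apply: le_trans (hB f); rewrite -sum_occ_adj le_eqVlt; apply/orP; left; apply/eqP.
by apply: eq_bigr => s _; rewrite adjC.
Qed.

Lemma rdiff_emp (B : R) : (1 < n)%N ->
  (forall f, 2 * n%:R - rd R n f x <= B) ->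
  \sum_(t | ~~ x t) rdiff t <= B * hd x y.
Proof.
move=> n1 hB; rewrite exchange_big /= mulr_sumr; apply: ler_sum => f _.
rewrite -mulr_suml ler_wpM2r//.
have := sum_emp_adj R n x f n1; have := hB f.
under [in X in _ -> _ -> X]eq_bigr do rewrite adjC.
by lra.
Qed.

(** [tau] fixes agreements, so both probabilities concern the same edges and the adjacency terms
    cancel. *)
Lemma acc_diff s t : 0 <= beta -> x s = y s -> x t = y t ->
  `|acc R n beta x s t - acc R n beta y (tau s) (tau t)|
  <= beta / (2 * n%:R) * (rdiff s + rdiff t).
Proof.
move=> b0 ss tt; rewrite !tau_id//.
apply: le_trans (logistic_lip _ _ _) _.
rewrite -mulrBr normrM ger0_norm ?divr_ge0 ?mulr_ge0//.
have -> : beta / (2 * n%:R) * (rdiff s + rdiff t)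
  = 4^-1 * (2 * beta / n%:R * (rdiff s + rdiff t)).
  by rewrite invfM; move: (n%:R^-1) => u; field.
apply: ler_wpM2l; first by rewrite invr_ge0.
apply: ler_wpM2l; first by rewrite divr_ge0 ?mulr_ge0.
have -> : rd R n t x - rd R n s x - (adj s t)%:R
    - (rd R n t y - rd R n s y - (adj s t)%:R)
  = (rd R n t x - rd R n t y) - (rd R n s x - rd R n s y) by ring.
by apply: le_trans (ler_normB _ _) _; rewrite addrC lerD ?rd_diff.
Qed.

(** In the bracket, 1/2 comes from swaps touching a disagreement and 4 beta p (1 - p) from
    acceptance discrepancies. Half of the M term comes from each of these two. The term in beta / (2
    n) is the adjacency error of [al], and 1 / N pays for the at most D / 2 pairs with t = tau s. *)
Lemma total_cost_le (p M : R) : 0 <= beta -> (1 < n)%N -> 0 <= p <= 1 ->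
  0 <= M -> k%:R = N%:R * p ->
  (forall e, `|rd R n e x - 2 * n%:R * p| <= M) ->
  (forall e, `|rd R n e y - 2 * n%:R * p| <= M) ->
  \sum_(s | x s) \sum_(t | ~~ x t)
    pair_cost (acc R n beta x s t) (acc R n beta y (tau s) (tau t)) s t
  <= k%:R * (N%:R - k%:R) * hd x y
   - hd x y * N%:R * (2^-1 - 4 * beta * p * (1 - p) - 2 * beta * M / n%:R
                      - beta / (2 * n%:R) - N%:R^-1).
Proof.
move=> b0 n1 /andP[p0 p1] M0 kE hx hy.
have n0 : 0 < n%:R :> R by rewrite ltr0n ltnW.
have N0 : 0 < N%:R :> R by rewrite ltr0n bin_gt0.
set al := 2^-1 - beta / (2 * n%:R) * (2 * M + 1).
have osc (z : config n) s t : (forall e, `|rd R n e z - 2 * n%:R * p| <= M) ->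
    `|rd R n t z - rd R n s z| <= 2 * M.
  move=> hz; have := hz t; have := hz s; rewrite !ler_norml.
  by move=> /andP[? ?] /andP[? ?]; lra.
have acc_ge (z : config n) s t : (forall e, `|rd R n e z - 2 * n%:R * p| <= M) ->
    al <= acc R n beta z s t.
  move=> hz; have := acc_half R n beta z s t M b0 (ltnW n1) (osc z s t hz).
  by rewrite ler_norml /al => /andP[? _]; lra.
pose D := hd x y.
have D0 : 0 <= D := hd_ge0 _ _.
apply: (@le_trans _ _ (\sum_(s | x s) \sum_(t | ~~ x t) (D
    + (beta / n%:R) * rdiff s + (beta / n%:R) * rdiff t
    + (al * 4) * (t == tau s)%:R + (- (al * 2)) * (x s != y s)%:R
    + (- (al * 2)) * (x t != y t)%:R))).
  apply: ler_sum => s xs; apply: ler_sum => t xt.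
  have h1 := pair_cost_le al (acc R n beta x s t) (acc R n beta y (tau s) (tau t))
     s t xs xt (acc_ge _ _ _ hx) (acc_ge _ _ _ hy).
  apply: le_trans h1 _.
  have rd0 e : 0 <= rdiff e by apply: sumr_ge0 => f _; rewrite mulr_ge0.
  have h2 : `|acc R n beta x s t - acc R n beta y (tau s) (tau t)|
      * ((x s == y s) && (x t == y t))%:R <= beta / (2 * n%:R) * (rdiff s + rdiff t).
    case: andP => [[/eqP ss /eqP tt]|_]; last first.
      by rewrite mulr0 mulr_ge0 ?divr_ge0 ?addr_ge0 ?mulr_ge0// ltW.
    by rewrite mulr1 acc_diff.
  have e3 : 2 * (beta / (2 * n%:R) * (rdiff s + rdiff t))
    = beta / n%:R * rdiff s + beta / n%:R * rdiff t by field; rewrite gt_eqF.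
  by rewrite -/D; lra.
have split6 : \sum_(s | x s) \sum_(t | ~~ x t) (D
    + (beta / n%:R) * rdiff s + (beta / n%:R) * rdiff t
    + (al * 4) * (t == tau s)%:R + (- (al * 2)) * (x s != y s)%:R
    + (- (al * 2)) * (x t != y t)%:R)
  = k%:R * (N%:R - k%:R) * D + beta / n%:R * ((N%:R - k%:R) * \sum_(s | x s) rdiff s)
    + beta / n%:R * (k%:R * \sum_(t | ~~ x t) rdiff t)
    + al * 4 * (\sum_(s | x s) \sum_(t | ~~ x t) (t == tau s)%:R)
    + - (al * 2) * ((N%:R - k%:R) * (D / 2)) + - (al * 2) * (k%:R * (D / 2)).
  rewrite -{1}sum_diff_occ -sum_diff_emp.
  rewrite -(sum_pairs_const R n k x)// -!(sum_pairs_l R n k x)//.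
  rewrite -!(sum_pairs_r R n k x)//.
  rewrite !mulr_sumr -!big_split /=; apply: eq_bigr => s _.
  by rewrite !mulr_sumr -!big_split.
rewrite split6.
have kN : N%:R - k%:R = N%:R * (1 - p) by rewrite kE; ring.
rewrite kN kE.
have p1' : 0 <= 1 - p by rewrite subr_ge0.
have occ : \sum_(s | x s) rdiff s <= (2 * n%:R * p + M) * D.
  by apply: rdiff_occ => f; have := hx f; rewrite ler_norml => /andP[_ ?]; lra.
have emp : \sum_(t | ~~ x t) rdiff t <= (2 * n%:R * (1 - p) + M) * D.
  apply: rdiff_emp => // f.
  by have := hx f; rewrite ler_norml => /andP[? _]; lra.
have mt := sum_matched_pairs; rewrite -/D in mt.
set mm := \sum_(s | x s) \sum_(t | ~~ x t) (t == tau s)%:R in mt *.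
have mm0 : 0 <= mm.
  by apply: sumr_ge0 => s _; apply: sumr_ge0 => t _; exact: ler0n.
have bn0 : 0 <= beta / n%:R by rewrite divr_ge0.
have al_le : al <= 2^-1.
  by rewrite /al gerBl mulr_ge0 ?divr_ge0 ?mulr_ge0 ?addr_ge0 ?mulr_ge0.
have t1 : beta / n%:R * (N%:R * (1 - p) * \sum_(s | x s) rdiff s)
   <= beta / n%:R * (N%:R * (1 - p) * ((2 * n%:R * p + M) * D)).
  by rewrite !ler_wpM2l// mulr_ge0// ltW.
have t2 : beta / n%:R * (N%:R * p * \sum_(t | ~~ x t) rdiff t)
   <= beta / n%:R * (N%:R * p * ((2 * n%:R * (1 - p) + M) * D)).
  by rewrite !ler_wpM2l// mulr_ge0// ltW.
have t3 : al * 4 * mm <= D.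
  apply: (@le_trans _ _ (2 * mm)); last by lra.
  by apply: ler_wpM2r => //; lra.
have e1 : beta / n%:R * (N%:R * (1 - p) * ((2 * n%:R * p + M) * D))
  + beta / n%:R * (N%:R * p * ((2 * n%:R * (1 - p) + M) * D))
  = D * N%:R * (4 * beta * p * (1 - p) + beta * M / n%:R).
  by field; rewrite gt_eqF.
have e2 : - (al * 2) * (N%:R * (1 - p) * (D / 2)) + - (al * 2) * (N%:R * p * (D / 2))
  = - (D * N%:R * (2^-1 - beta * M / n%:R - beta / (2 * n%:R))).
  by rewrite /al; field; rewrite gt_eqF.
have e3 : D = D * N%:R * N%:R^-1 by rewrite mulfK// gt_eqF.
rewrite -/D.
have -> : N%:R * p * (N%:R * (1 - p)) * D -
  D * N%:R * (2^-1 - 4 * beta * p * (1 - p) - 2 * beta * M / n%:R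
    - beta / (2 * n%:R) - N%:R^-1)
  = N%:R * p * (N%:R * (1 - p)) * D
   + D * N%:R * (4 * beta * p * (1 - p) + beta * M / n%:R)
   - (D * N%:R * (2^-1 - beta * M / n%:R - beta / (2 * n%:R)))
   + D * N%:R * N%:R^-1.
  by ring.
rewrite -e3.
by lra.
Qed.

End Matched.
End Coupling.

(** * The restricted chain *)

Section RestrictedChain.
Variables (R : realType) (n k : nat) (p beta eps : R).
Implicit Types x y : config n.
Local Notation N := (nedges n).
Hypothesis n_gt1 : (1 < n)%N.
Hypothesis kE : k%:R = N%:R * p.
Hypothesis p01 : 0 < p < 1.

Lemma N_gt0 : 0 < N%:R :> R.
Proof. by rewrite ltr0n bin_gt0. Qed.

Lemma NkE : N%:R - k%:R = N%:R * (1 - p) :> R.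
Proof. by rewrite kE; ring. Qed.

Lemma npairs_gt0 : 0 < k%:R * (N%:R - k%:R) :> R.
Proof.
have N0 := N_gt0; case/andP: p01 => p0 p1.
by rewrite NkE kE !mulr_gt0// subr_gt0.
Qed.

Lemma k_leN : (k <= N)%N.
Proof.
rewrite -(ler_nat R) -subr_ge0 NkE; have N0 := N_gt0; case/andP: p01 => p0 p1.
by rewrite mulr_ge0 ?subr_ge0 ?ltW.
Qed.

Lemma GammaP (d : R) x :
  reflect (x \in Omega n k /\ forall e, `|rd R n e x - 2 * n%:R * p| <= 2 * n%:R * d)
    (x \in Gamma n k p d).
Proof.
have n2 : 0 < 2 * n%:R :> R by rewrite mulr_gt0// ltr0n ltnW.
rewrite [x \in Gamma _ _ _ _]inE.
have eqv e : (p - d <= rdens R e x <= p + d)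
    = (`|rd R n e x - 2 * n%:R * p| <= 2 * n%:R * d).
  rewrite /rdens -/(rd R n e x) ler_pdivlMr// ler_pdivrMr// ler_norml.
  by congr (_ && _); apply/idP/idP => ?; lra.
apply: (iffP andP) => -[xO h]; split => //.
  by move=> e; rewrite -eqv; move/forallP: h.
by apply/forallP => e; rewrite eqv.
Qed.

Lemma Gamma_Omega (d : R) x : x \in Gamma n k p d -> x \in Omega n k.
Proof. by case/GammaP. Qed.

Lemma rd_swap_near x (e s t : edge n) : x s -> ~~ x t ->
  `|rd R n e (swap x s t) - rd R n e x| <= 1.
Proof.
move=> xs xt; rewrite rd_swap// ler_norml.
by case: (adj s e); case: (adj t e); apply/andP; split; rewrite /= ?mulr0n ?mulr1n; lra.
Qed.

Lemma Gamma_half x : 0 <= eps -> x \in Gamma n k p (eps / 2) -> x \in Gamma n k p eps.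
Proof.
move=> e0 /GammaP[xO h]; apply/GammaP; split => // e; apply: le_trans (h e) _.
by rewrite ler_wpM2l ?mulr_ge0//; lra.
Qed.

(** The two levels differ by n eps >= 1 in each count, and a swap moves a count by at most 1. Thus
    no proposal made in Gamma_{eps/2} is suppressed by the restriction. *)
Lemma Gamma_swap x s t : 1 <= n%:R * eps -> x \in Gamma n k p (eps / 2) ->
  x s -> ~~ x t -> swap x s t \in Gamma n k p eps.
Proof.
move=> ne /GammaP[xO h] xs xt; apply/GammaP; split => [|e].
  by rewrite (swap_Omega R).
have h1 := h e; have h2 := rd_swap_near x e s t xs xt.
have -> : rd R n e (swap x s t) - 2 * n%:R * p
  = (rd R n e x - 2 * n%:R * p) + (rd R n e (swap x s t) - rd R n e x) by ring.
apply: le_trans (ler_normD _ _) _; lra.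
Qed.

Local Notation Gm := (Gamma n k p eps).
Local Notation Pe := (@P_eps R n k p beta eps).
Local Notation Po := (@P_offdiag R n k beta).

Lemma P_offxx x : Po x x = 0.
Proof. by rewrite /P_offdiag is_swapxx. Qed.

Lemma op_on_P_eps x (g : config n -> R) : x \in Gm ->
  op_on R _ Gm Pe g x = g x + \sum_(y in Gm) Po x y * (g y - g x).
Proof.
move=> xG; rewrite /op_on (bigD1 x)//= [in RHS](bigD1 x)//= subrr mulr0 add0r.
rewrite {1}/P_eps eqxx mulrBl mul1r -addrA; congr (_ + _).
rewrite addrC mulr_suml -sumrB; apply: eq_bigr => y /andP[yG yx].
by rewrite /P_eps /P_Kaw eq_sym (negbTE yx); ring.
Qed.

Lemma P_eps_sum1 x : x \in Gm -> \sum_(y in Gm) Pe x y = 1.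
Proof.
move=> xG; have := op_on_P_eps x (fun=> 1) xG.
rewrite [X in _ + X]big1 ?addr0 => [h|y _]; last by rewrite subrr mulr0.
by rewrite -[RHS]h; apply: eq_bigr => y _; rewrite mulr1.
Qed.

Lemma sum_P_off_le1 x (A : {set config n}) : x \in Omega n k ->
  \sum_(y in A) Po x y <= 1.
Proof.
move=> xO; under eq_bigr do rewrite -[P_offdiag _ _ _ _]mulr1.
rewrite sum_P_off// ler_pdivrMl ?npairs_gt0// -(sum_pairs_const R n k x)//.
apply: ler_sum => s xs; apply: ler_sum => t xt.
have := acc_le1 R n beta x s t; have := acc_gt0 R n beta x s t.
by case: (_ \in A); rewrite /= ?mulr1n ?mulr0n; lra.
Qed.

Lemma P_eps_ge0 x y : x \in Gm -> y \in Gm -> 0 <= Pe x y.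
Proof.
move=> xG yG; rewrite /P_eps; case: ifP => xy; last first.
  by rewrite /P_Kaw xy P_off_ge0// k_leN.
rewrite subr_ge0.
have := sum_P_off_le1 x Gm (Gamma_Omega _ _ xG).
rewrite (bigD1 x)//= P_offxx add0r; apply: le_trans.
by apply: ler_sum => z /andP[_ zx]; rewrite /P_Kaw eq_sym (negbTE zx).
Qed.

Lemma pi_eps_ge0 x : 0 <= pi_eps k p beta eps x.
Proof.
rewrite /pi_eps /cond_meas; case: ifP => // _.
by rewrite divr_ge0 ?mu_ge0// sumr_ge0// => y _; rewrite mu_ge0.
Qed.

Lemma mu_Gamma_gt0 x : x \in Gm -> 0 < \sum_(y in Gm) mu k beta y.
Proof.
move=> xG; rewrite (bigD1 x)//= ltr_pwDl ?mu_gt0 ?(Gamma_Omega _ _ xG)//.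
by rewrite sumr_ge0// => y _; rewrite mu_ge0.
Qed.

Lemma pi_eps_sum1 x : x \in Gm -> \sum_(y in Gm) pi_eps k p beta eps y = 1.
Proof.
move=> xG; have h := mu_Gamma_gt0 x xG.
rewrite -[RHS](divff (lt0r_neq0 h)) mulr_suml.
by apply: eq_bigr => y yG; rewrite /pi_eps /cond_meas yG.
Qed.

Lemma P_eps_rev x y : x \in Gm -> y \in Gm ->
  pi_eps k p beta eps x * Pe x y = pi_eps k p beta eps y * Pe y x.
Proof.
move=> xG yG; have [->//|xy] := eqVneq x y.
rewrite /P_eps /P_Kaw (eq_sym y x) (negbTE xy) /pi_eps /cond_meas xG yG.
by rewrite mulrAC P_off_rev mulrAC.
Qed.

Lemma op_on_P_eps_good x (g : config n -> R) :
  0 <= eps -> 1 <= n%:R * eps -> x \in Gamma n k p (eps / 2) ->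
  op_on R _ Gm Pe g x = (k%:R * (N%:R - k%:R))^-1 *
    \sum_(s | x s) \sum_(t | ~~ x t)
       (g x + acc R n beta x s t * (g (swap x s t) - g x)).
Proof.
move=> e0 ne xG; have xO := Gamma_Omega _ _ xG.
rewrite op_on_P_eps ?Gamma_half// sum_P_off//.
have kn := npairs_gt0.
rewrite -[X in X + _](mulKf (lt0r_neq0 kn)) -mulrDr; congr (_ * _).
rewrite -(sum_pairs_const R n k x)// -big_split; apply: eq_bigr => s xs.
rewrite -big_split; apply: eq_bigr => t xt /=.
by rewrite Gamma_swap// mul1r.
Qed.

Lemma P_eps_contraction (eta : R) : 0 <= beta -> 0 < eps -> 1 <= n%:R * eps ->
  0 <= eta ->
  eta <= 2^-1 - 4 * beta * p * (1 - p) - 2 * beta * eps - beta / (2 * n%:R) - N%:R^-1 ->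
  forall x y, x \in Gamma n k p (eps / 2) -> y \in Gamma n k p (eps / 2) ->
  forall (g u : config n -> R) (a : R), 0 <= a ->
  (forall x' y', x' \in Gm -> y' \in Gm ->
    g x' - g y' <= a * hd R n x' y' + u x' + u y') ->
  op_on R _ Gm Pe g x - op_on R _ Gm Pe g y
  <= a * (1 - eta / N%:R) * hd R n x y + op_on R _ Gm Pe u x + op_on R _ Gm Pe u y.
Proof.
have arith1 (u1 u2 v1 v2 c : R) :
  u1 - v1 - (u2 + v2) <= c -> u1 - u2 <= c + v1 + v2 by lra.
have arith2 (u1 u2 v1 v2 c : R) :
  u1 - u2 <= c + v1 + v2 -> u1 - v1 - (u2 + v2) <= c by lra.
move=> b0 e0 ne eta0 etaE x y xG yG g u a a0 hg.
have xO := Gamma_Omega _ _ xG; have yO := Gamma_Omega _ _ yG.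
have N0 := N_gt0; have kn := npairs_gt0.
have n0 : 0 < n%:R :> R by rewrite ltr0n ltnW.
have [tau [tauK y_tau tau_id]] := exists_matching n k x y xO yO.
(* Moving the errors into two different functions leaves a pure contraction statement, to which
   [pair_transport] applies. *)
pose g1 z := g z - u z; pose g2 z := g z + u z.
have lin1 z : op_on R _ Gm Pe g1 z = op_on R _ Gm Pe g z - op_on R _ Gm Pe u z.
  by rewrite /op_on -sumrB; apply: eq_bigr => w _; rewrite -mulrBr.
have lin2 z : op_on R _ Gm Pe g2 z = op_on R _ Gm Pe g z + op_on R _ Gm Pe u z.
  by rewrite /op_on -big_split /=; apply: eq_bigr => w _; rewrite -mulrDr.
suff : op_on R _ Gm Pe g1 x - op_on R _ Gm Pe g2 y <= a * (1 - eta / N%:R) * hd R n x y.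
  by rewrite lin1 lin2; exact: arith1.
rewrite !op_on_P_eps_good ?(ltW e0)//.
rewrite (sum_pairs_matched R n x y tau tauK y_tau).
rewrite -mulrBr -sumrB ler_pdivrMl//.
have hg' z w : z \in Gm -> w \in Gm -> g1 z - g2 w <= a * hd R n z w.
  by move=> zG wG; apply: arith2; exact: hg.
apply: (@le_trans _ _ (a * \sum_(s | x s) \sum_(t | ~~ x t)
    pair_cost R n x y tau (acc R n beta x s t) (acc R n beta y (tau s) (tau t)) s t)).
  rewrite mulr_sumr; apply: ler_sum => s xs.
  rewrite -sumrB mulr_sumr; apply: ler_sum => t xt.
  have acc01 z s' t' : 0 <= acc R n beta z s' t' <= 1.
    by rewrite acc_le1 ltW ?acc_gt0.
  have ys' : y (tau s) by rewrite y_tau.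
  have yt' : ~~ y (tau t) by rewrite y_tau.
  by apply: pair_transport => //; apply: hg'; rewrite ?Gamma_swap// Gamma_half// ltW.
have := total_cost_le R n k beta x y tau tauK y_tau tau_id xO yO p (n%:R * eps).
have e2 : 2 * n%:R * (eps / 2) = n%:R * eps by field.
case/GammaP: xG => _ hx; case/GammaP: yG => _ hy.
rewrite e2 in hx hy; case/andP: p01 => p0 p1.
move=> /(_ b0 n_gt1 _ _ kE hx hy); rewrite (ltW p0) (ltW p1).
move=> /(_ isT) H; have {}H := H (mulr_ge0 (ltW n0) (ltW e0)).
have -> : k%:R * (N%:R - k%:R) * (a * (1 - eta / N%:R) * hd R n x y)
  = a * (k%:R * (N%:R - k%:R) * ((1 - eta / N%:R) * hd R n x y)) by ring.
apply: ler_wpM2l => //; apply: le_trans H _.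
have D0 := hd_ge0 R n x y.
have -> : 2 * beta * (n%:R * eps) / n%:R = 2 * beta * eps.
  by field; rewrite gt_eqF.
set z := (_ - _ - _ - _ - _) in etaE *.
have h1 : hd R n x y * N%:R * eta <= hd R n x y * N%:R * z.
  by rewrite ler_wpM2l// mulr_ge0// ltW.
(* As k (N - k) <= N^2, a total gain of eta N over k (N - k) equally likely proposals is at least
   eta / N per step. *)
have h2 : k%:R * (N%:R - k%:R) * (eta / N%:R * hd R n x y)
    <= hd R n x y * N%:R * eta.
  have -> : hd R n x y * N%:R * eta = (N%:R * N%:R) * (eta / N%:R * hd R n x y).
    by field; rewrite gt_eqF.
  rewrite ler_wpM2r ?mulr_ge0 ?invr_ge0 ?(ltW N0)//.
  rewrite NkE kE mulrACA ler_piMr ?mulr_ge0 ?(ltW N0)//.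
  by nra.
by lra.
Qed.

End RestrictedChain.

(** * Drift of the exponential Lyapunov function *)

Section Drift.
Variables (R : realType) (n k : nat) (p beta : R).
Implicit Types x y : config n.
Implicit Types e s t : edge n.
Local Notation N := (nedges n).
Hypothesis n_gt1 : (1 < n)%N.
Hypothesis kE : k%:R = N%:R * p.
Hypothesis p01 : 0 < p < 1.
Hypothesis beta_ge0 : 0 <= beta.

Let n_gt0 : 0 < n%:R :> R. Proof. by rewrite ltr0n ltnW. Qed.

Definition dev e x : R := rd R n e x - 2 * n%:R * p.

Lemma dev_swap e x s t : x s -> ~~ x t ->
  dev e (swap x s t) = dev e x + ((adj t e)%:R - (adj s e)%:R).
Proof. by move=> xs xt; rewrite /dev rd_swap//; ring. Qed.

(** Bare proposals pull the count at e linearly to 2 p (n - 2); 4 p is the offset from the centring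
    2 n p. *)
Lemma sum_adj_diff x e : x \in Omega n k ->
  \sum_(s | x s) \sum_(t | ~~ x t) ((adj t e)%:R - (adj s e)%:R)
  = - (N%:R * (dev e x + 4 * p)).
Proof.
move=> xO; under eq_bigr do rewrite sumrB; rewrite sumrB.
rewrite (sum_pairs_r R n k x (fun t => (adj t e)%:R))//.
rewrite (sum_pairs_l R n k x (fun s => (adj s e)%:R))//.
by rewrite sum_emp_adj// sum_occ_adj /dev kE; ring.
Qed.

Lemma sum_adj_sum_le x e M : x \in Omega n k -> `|dev e x| <= M ->
  \sum_(s | x s) \sum_(t | ~~ x t) ((adj t e)%:R + (adj s e)%:R)
  <= N%:R * (4 * n%:R * p * (1 - p) + M).
Proof.
move=> xO hM; under eq_bigr do rewrite big_split /=; rewrite big_split /=.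
rewrite (sum_pairs_r R n k x (fun t => (adj t e)%:R))//.
rewrite (sum_pairs_l R n k x (fun s => (adj s e)%:R))//.
rewrite sum_emp_adj// sum_occ_adj.
have -> : k%:R * (2 * (n%:R - 2) - rd R n e x) + (N%:R - k%:R) * rd R n e x
  = N%:R * (4 * n%:R * p * (1 - p) - 4 * p + (1 - 2 * p) * dev e x).
  by rewrite /dev kE; ring.
apply: ler_wpM2l; first exact: ler0n.
have h : `|(1 - 2 * p) * dev e x| <= 1 * M.
  rewrite normrM ler_pM//; case/andP: p01 => p0 p1.
  by rewrite ler_norml; apply/andP; split; lra.
have := le_trans (ler_norm _) h; case/andP: p01 => p0 p1; lra.
Qed.

(** z is the sign in the exponent. Replacing a by 1/2 costs [zeta] and the second-order term costs 2
    [lam]; both are charged to jt + js, which dominates |jt - js| and its square for 0/1 values. *)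
Lemma drift_pair (a z lam jt js zeta : R) : 0 < a <= 1 -> `|a - 2^-1| <= zeta ->
  0 <= lam <= 2^-1 -> `|z| = 1 ->
  (jt = 0 \/ jt = 1) -> (js = 0 \/ js = 1) ->
  a * (expR (lam * z * (jt - js)) - 1)
  <= lam * (2^-1 * z * (jt - js) + (zeta + 2 * lam) * (jt + js)).
Proof.
move=> /andP[a0 a1] hz /andP[l0 l1] z1 hjt hjs.
have jd : `|jt - js| <= 1.
  case: hjt => ->; case: hjs => ->;
  by rewrite ?subrr ?subr0 ?sub0r ?normrN ?normr1 ?normr0.
have jd2 : (jt - js) ^+ 2 <= jt + js.
  by case: hjt => ->; case: hjs => ->; rewrite expr2; lra.
have z2 : z ^+ 2 = 1 by rewrite -real_normK ?num_real// z1 expr1n.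
have jj : `|z * (jt - js)| <= jt + js.
  rewrite normrM z1 mul1r.
  by case: hjt => ->; case: hjs => ->;
  rewrite ?subrr ?subr0 ?sub0r ?normrN ?normr1 ?normr0; lra.
have lz : `|lam * z * (jt - js)| <= 2^-1.
  rewrite !normrM z1 mulr1 ger0_norm// -[leRHS]mulr1.
  by rewrite ler_pM.
have h1 := expR_quad_le R _ lz.
have js0 : 0 <= jt + js by case: hjt => ->; case: hjs => ->; lra.
have h2 : (lam * z * (jt - js)) ^+ 2 <= lam ^+ 2 * (jt + js).
  have -> : (lam * z * (jt - js)) ^+ 2 = lam ^+ 2 * (z ^+ 2 * (jt - js) ^+ 2) by ring.
  by rewrite z2 mul1r ler_wpM2l ?sqr_ge0.
apply: (@le_trans _ _ (a * (lam * z * (jt - js) + 2 * (lam ^+ 2 * (jt + js))))).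
  by rewrite ler_pM2l//; lra.
have h3 : a * (2 * (lam ^+ 2 * (jt + js))) <= 2 * (lam ^+ 2 * (jt + js)).
  by rewrite ler_piMl// mulr_ge0// mulr_ge0// sqr_ge0.
have h4 : (a - 2^-1) * (z * (jt - js)) <= zeta * (jt + js).
  apply: le_trans (ler_norm _) _; rewrite normrM ler_pM//.
have h5 := ler_wpM2l l0 h4.
rewrite mulrDr.
have -> : lam * (2^-1 * z * (jt - js) + (zeta + 2 * lam) * (jt + js))
  = lam * (2^-1 * (z * (jt - js))) + lam * (zeta * (jt + js))
    + 2 * (lam ^+ 2 * (jt + js)) by ring.
have -> : a * (lam * z * (jt - js)) = lam * ((a - 2^-1) * (z * (jt - js)))
   + lam * (2^-1 * (z * (jt - js))) by ring.
by lra.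
Qed.

Lemma drift_term x e (z lam M : R) : x \in Omega n k -> `|z| = 1 ->
  0 <= lam <= 2^-1 -> (forall e', `|dev e' x| <= M) ->
  \sum_(s | x s) \sum_(t | ~~ x t) acc R n beta x s t *
     (expR (lam * z * dev e (swap x s t)) - expR (lam * z * dev e x))
  <= lam * N%:R * (expR (lam * z * dev e x) *
     (- (2^-1 * (z * dev e x)) + 2
      + beta / (2 * n%:R) * (2 * M + 1) * (4 * n%:R * p * (1 - p) + M)
      + 2 * lam * (n%:R + M))).
Proof.
move=> xO z1 lam01 hM; case/andP: (lam01) => l0 l1.
have M0 : 0 <= M := le_trans (normr_ge0 _) (hM e).
set E := expR _; set zeta := beta / (2 * n%:R) * (2 * M + 1).
have E0 : 0 < E by exact: expR_gt0.
have zeta0 : 0 <= zeta by rewrite /zeta mulr_ge0 ?divr_ge0 ?addr_ge0 ?mulr_ge0.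
have acch s t : `|acc R n beta x s t - 2^-1| <= zeta.
  apply: acc_half => //; first by rewrite ltnW.
  have := hM s; have := hM t; rewrite /dev !ler_norml.
  by move=> /andP[? ?] /andP[? ?]; lra.
apply: (@le_trans _ _ (\sum_(s | x s) \sum_(t | ~~ x t)
   (E * lam * (2^-1 * z) * ((adj t e)%:R - (adj s e)%:R)
    + E * lam * (zeta + 2 * lam) * ((adj t e)%:R + (adj s e)%:R)))).
  apply: ler_sum => s xs; apply: ler_sum => t xt.
  rewrite dev_swap// [lam * z * (_ + _)]mulrDr expRD -/E.
  have b01 (b : bool) : b%:R = 0 :> R \/ b%:R = 1 :> R.
    by case: b; [right|left].
  have acc01 : 0 < acc R n beta x s t <= 1 by rewrite acc_gt0 acc_le1.
  have h := drift_pair _ _ _ _ _ _ acc01 (acch s t) lam01 z1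
    (b01 (adj t e)) (b01 (adj s e)).
  have := ler_wpM2l (ltW E0) h; lra.
under eq_bigr do rewrite big_split /= -!mulr_sumr.
rewrite big_split /= -!mulr_sumr sum_adj_diff//.
have h := sum_adj_sum_le x e M xO (hM e).
set S := \sum_(s | x s) _ in h *.
have c0 : 0 <= E * lam * (zeta + 2 * lam).
  by apply: mulr_ge0; [apply: mulr_ge0 => //; exact: ltW|rewrite addr_ge0// mulr_ge0].
have h2 := ler_wpM2l c0 h.
case/andP: (p01) => p0 p1.
(* Used only in the [lam] term. In the [zeta] term the exact factor must survive, as it becomes 4
   beta p (1 - p). *)
have q4 : 4 * n%:R * p * (1 - p) <= n%:R.
  have : 0 <= n%:R * (1 - 2 * p) ^+ 2 by rewrite mulr_ge0 ?sqr_ge0.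
  have -> : n%:R * (1 - 2 * p) ^+ 2 = n%:R - 4 * n%:R * p * (1 - p) by ring.
  by rewrite subr_ge0.
apply: (@le_trans _ _ (lam * N%:R * (E * (- (2^-1 * (z * dev e x)) - 2 * (z * p)
   + (zeta + 2 * lam) * (4 * n%:R * p * (1 - p) + M))))).
  rewrite le_eqVlt in h2.
  have -> : lam * N%:R * (E * (- (2^-1 * (z * dev e x)) - 2 * (z * p)
   + (zeta + 2 * lam) * (4 * n%:R * p * (1 - p) + M)))
   = E * lam * (2^-1 * z) * - (N%:R * (dev e x + 4 * p))
   + E * lam * (zeta + 2 * lam) * (N%:R * (4 * n%:R * p * (1 - p) + M)) by field.
  by rewrite lerD2l le_eqVlt.
apply: ler_wpM2l; first by rewrite mulr_ge0.
apply: ler_wpM2l; first exact: ltW.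
have hzp : - (2 * (z * p)) <= 2.
  have : `|z * p| <= 1 * 1 by rewrite normrM z1 ler_pM// ger0_norm ltW.
  by rewrite mulr1 ler_norml => /andP[? _]; lra.
have hl : 2 * lam * (4 * n%:R * p * (1 - p) + M) <= 2 * lam * (n%:R + M).
  by rewrite ler_wpM2l ?mulr_ge0// lerD2r.
rewrite mulrDl.
lra.
Qed.

(** * The Lyapunov function and its drift *)

Variable lam : R.
Hypothesis lam01 : 0 < lam <= 2^-1.

(** The factors 1 and -1 make both halves instances of [drift_term]. *)
Definition lyap x : R := \sum_e (expR (lam * 1 * dev e x) + expR (lam * -1 * dev e x)).

(** On [Omega n k], this is k (N - k) times the generator of the unrestricted chain applied to
    [lyap]. *)
Definition drift x : R := \sum_(s | x s) \sum_(t | ~~ x t)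
  acc R n beta x s t * (lyap (swap x s t) - lyap x).

Lemma driftE x : drift x = \sum_e
  (\sum_(s | x s) \sum_(t | ~~ x t) acc R n beta x s t *
     (expR (lam * 1 * dev e (swap x s t)) - expR (lam * 1 * dev e x))
  + \sum_(s | x s) \sum_(t | ~~ x t) acc R n beta x s t *
     (expR (lam * -1 * dev e (swap x s t)) - expR (lam * -1 * dev e x))).
Proof.
rewrite big_split /= exchange_big /=.
rewrite [X in _ + X]exchange_big /= -big_split /=.
apply: eq_bigr => s xs.
rewrite exchange_big /=.
rewrite [X in _ + X]exchange_big /= -big_split /=.
apply: eq_bigr => t xt; rewrite -!mulr_sumr -mulrDr; congr (_ * _).
by rewrite -big_split /= /lyap -sumrB; apply: eq_bigr => e _; ring.
Qed.

Lemma lyap_le x M : (forall e, `|dev e x| <= M) -> lyap x <= 2 * N%:R * expR (lam * M).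
Proof.
move=> hM; case/andP: lam01 => l0 _.
have -> : 2 * N%:R * expR (lam * M) = \sum_(e : edge n) (expR (lam * M) + expR (lam * M)).
  rewrite sumr_const card_edge -[in RHS]mulr_natl -/(nedges n); ring.
apply: ler_sum => e _; have := hM e; rewrite ler_norml => /andP[h1 h2].
have h3 : lam * dev e x <= lam * M by rewrite ler_pM2l.
have h4 : - (lam * dev e x) <= lam * M by rewrite -mulrN ler_pM2l//; lra.
by rewrite mulr1 mulrN1 mulNr; apply: lerD; rewrite ler_expR.
Qed.

Lemma lyap_ge x e : expR (lam * `|dev e x|) <= lyap x.
Proof.
rewrite /lyap (bigD1 e)//=.
have : 0 <= \sum_(i | i != e) (expR (lam * 1 * dev i x) + expR (lam * -1 * dev i x)).
  by apply: sumr_ge0 => i _; rewrite addr_ge0 ?expR_ge0.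
move: (\sum_(i | _) _) => S S0.
have e1 := expR_ge0 (lam * dev e x); have e2 := expR_ge0 (- (lam * dev e x)).
by have [d0|d0] := ler0P (dev e x); rewrite mulr1 mulrN1 mulNr ?mulrN; lra.
Qed.

(** A crude bound for small deviations: a swap changes each exponent by at most lam <= 1/2, so it at
    most doubles [lyap]. *)
Lemma drift_le_lyap x : x \in Omega n k -> drift x <= N%:R ^+ 2 * lyap x.
Proof.
move=> xO; case/andP: lam01 => l0 l1.
have L0 : 0 <= lyap x by apply: sumr_ge0 => e _; rewrite addr_ge0 ?expR_ge0.
apply: (@le_trans _ _ (\sum_(s | x s) \sum_(t | ~~ x t) lyap x)).
  apply: ler_sum => s xs; apply: ler_sum => t xt.
  have hl : lyap (swap x s t) - lyap x <= lyap x.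
    suff : lyap (swap x s t) <= 2 * lyap x by lra.
    rewrite /lyap mulr_sumr; apply: ler_sum => e _.
    have e2 : expR (2^-1 : R) <= 2.
      have := @expR_quad_le R (2^-1); rewrite ger0_norm ?invr_ge0// lexx => /(_ isT).
      by rewrite expr2; lra.
    have step (z : R) : `|z| = 1 ->
       expR (lam * z * dev e (swap x s t)) <= 2 * expR (lam * z * dev e x).
      move=> z1; rewrite dev_swap// mulrDr expRD mulrC ler_pM2r ?expR_gt0//.
      apply: le_trans e2; rewrite ler_expR.
      apply: le_trans (ler_norm _) _; rewrite !normrM z1 mulr1 gtr0_norm//.
      rewrite -[leRHS]mulr1 ler_pM//; first exact: ltW.
      by case: (adj t e); case: (adj s e);
      rewrite ?subrr ?subr0 ?sub0r ?normrN ?normr1 ?normr0.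
    by rewrite [2 * (_ + _)]mulrDr lerD// step// ?normrN normr1.
  have [neg|pos] := leP (lyap (swap x s t) - lyap x) 0.
    by apply: le_trans L0; rewrite mulr_ge0_le0 ?(ltW (acc_gt0 _ _ _ _ _ _)).
  apply: le_trans hl; rewrite ler_piMl ?(ltW pos)//; exact: acc_le1.
rewrite (sum_pairs_const R n k)// ler_wpM2r// expr2.
have kN : k%:R <= N%:R :> R.
  rewrite -subr_ge0 kE; have N0 := ler0n R N; case/andP: p01 => p0 p1.
  by rewrite -[X in X - _]mulr1 -mulrBr mulr_ge0// subr_ge0 ltW.
by apply: ler_pM; rewrite ?subr_ge0 ?gerBl.
Qed.

(** The edge of maximal deviation alone beats all others: an edge can contribute positively only
    below deviation (1 - 2 eta) M, where its exponential is smaller by e^(- 2 lam eta M), and this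
    factor absorbs the 2 N terms. *)
Lemma drift_neg x e0 (eta M : R) : x \in Omega n k -> 0 < eta <= 2^-1 ->
  `|dev e0 x| = M -> (forall e, `|dev e x| <= M) ->
  2 + beta / (2 * n%:R) * (2 * M + 1) * (4 * n%:R * p * (1 - p) + M)
    + 2 * lam * (n%:R + M) <= (2^-1 - eta) * M ->
  2 * N%:R * expR (- (2 * lam * eta * M)) <= eta / 2 ->
  drift x <= - (lam * N%:R * (eta / 2) * M * expR (lam * M)).
Proof.
move=> xO /andP[eta0 eta1] he0 hM hB hN; case/andP: (lam01) => l0 l1.
have M0 : 0 <= M by rewrite -he0.
have lam01' : 0 <= lam <= 2^-1 by rewrite ltW.
(* Up to the factor lam N, [phi z] bounds the drift of one exponential at signed deviation z. *)
pose phi (z : R) := expR (lam * z) * (- (2^-1 * z) + (2^-1 - eta) * M).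
pose b := M * expR (lam * ((1 - 2 * eta) * M)).
have b0 : 0 <= b by rewrite mulr_ge0 ?expR_ge0.
have phib z : `|z| <= M -> phi z <= b.
  rewrite ler_norml /phi => /andP[z1 z2].
  have [hz|hz] := leP ((1 - 2 * eta) * M) z.
    apply: le_trans b0; rewrite mulr_ge0_le0 ?expR_ge0//; lra.
  apply: (@le_trans _ _ (expR (lam * z) * M)).
    rewrite ler_wpM2l ?expR_ge0//.
    have : 0 <= eta * M by rewrite mulr_ge0// ltW.
    lra.
  by rewrite /b mulrC ler_wpM2l// ler_expR ler_pM2l// ltW.
have term e (z : R) : `|z| = 1 ->
  \sum_(s | x s) \sum_(t | ~~ x t) acc R n beta x s t *
     (expR (lam * z * dev e (swap x s t)) - expR (lam * z * dev e x))
  <= lam * N%:R * phi (z * dev e x).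
  move=> z1; apply: le_trans (drift_term x e z lam M xO z1 lam01' hM) _.
  rewrite ler_wpM2l ?mulr_ge0 ?(ltW l0)// /phi mulrA ler_wpM2l ?expR_ge0//.
  by lra.
have dz e z : `|z| = 1 -> `|z * dev e x| <= M by move=> z1; rewrite normrM z1 mul1r.
have n1 : `|1| = 1 :> R by rewrite normr1.
have nN1 : `|-1| = 1 :> R by rewrite normrN normr1.
have phiM : phi (1 * dev e0 x) + phi (-1 * dev e0 x) <= - (eta * M * expR (lam * M)) + b.
  have eM : phi M = - (eta * M * expR (lam * M)) by rewrite /phi; field.
  have [d0|d0] := ler0P (dev e0 x).
    have dE : -1 * dev e0 x = M by rewrite -he0 ler0_norm// mulN1r.
    by rewrite dE eM addrC lerD2l; exact: phib (dz _ _ n1).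
  have dE : 1 * dev e0 x = M by rewrite -he0 gtr0_norm// mul1r.
  by rewrite dE eM lerD2l; exact: phib (dz _ _ nN1).
apply: (@le_trans _ _ (lam * N%:R * (- (eta * M * expR (lam * M)) + 2 * N%:R * b))).
  rewrite driftE.
  apply: (@le_trans _ _ (\sum_e (lam * N%:R * (phi (1 * dev e x) + phi (-1 * dev e x))))).
    by apply: ler_sum => e _; rewrite [lam * _ * (_ + _)]mulrDr lerD// term.
  rewrite -mulr_sumr ler_wpM2l ?mulr_ge0 ?(ltW l0)//.
  have cst : 2 * N%:R * b = \sum_(e : edge n) (b + b).
    by rewrite sumr_const card_edge -[in RHS]mulr_natl -/(nedges n); ring.
  rewrite cst (bigD1 e0)//= [in leRHS](bigD1 e0)//= addrA lerD//.
    by apply: le_trans phiM _; lra.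
  by apply: ler_sum => e _; rewrite lerD// phib// dz.
have -> : - (lam * N%:R * (eta / 2) * M * expR (lam * M))
  = lam * N%:R *
    (- (eta * M * expR (lam * M)) + (eta / 2) * (M * expR (lam * M))) by field.
rewrite ler_wpM2l ?mulr_ge0 ?(ltW l0)// lerD2l.
have -> : 2 * N%:R * b = (2 * N%:R * expR (- (2 * lam * eta * M))) * (M * expR (lam * M)).
  rewrite /b (_ : lam * ((1 - 2 * eta) * M)
    = - (2 * lam * eta * M) + lam * M) ?expRD; ring.
by rewrite ler_wpM2r// mulr_ge0 ?expR_ge0.
Qed.

End Drift.

(** * Concentration on the regular set *)

Section Concentration.
Variables (R : realType) (n k : nat) (p beta : R).
Implicit Types x y : config n.
Implicit Types e s t : edge n.
Local Notation N := (nedges n).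
Hypothesis n_gt1 : (1 < n)%N.
Hypothesis kE : k%:R = N%:R * p.
Hypothesis p01 : 0 < p < 1.
Hypothesis beta_ge0 : 0 <= beta.

Lemma Kawasaki_stationary (W : config n -> R) :
  \sum_(x in Omega n k) mu k beta x *
    (\sum_(s | x s) \sum_(t | ~~ x t) acc R n beta x s t * (W (swap x s t) - W x)) = 0.
Proof.
have kn := npairs_gt0 R n k p n_gt1 kE p01.
pose S := \sum_(x in Omega n k) \sum_(y in Omega n k)
  mu k beta x * P_offdiag k beta x y * (W y - W x).
have S0 : S = 0.
  have SN : S = - S.
    rewrite {1}/S exchange_big /= /S -sumrN; apply: eq_bigr => y yO.
    rewrite -sumrN; apply: eq_bigr => x xO.
    by rewrite P_off_rev -mulrN opprB.
  by move: SN; clearbody S; lra.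
apply: (mulfI (invr_neq0 (lt0r_neq0 kn))); transitivity S; last by rewrite S0 mulr0.
rewrite /S.
rewrite mulr_sumr; apply: eq_bigr => x xO.
under [RHS]eq_bigr do rewrite -mulrA.
rewrite -mulr_sumr sum_P_off// mulrCA; congr (_ * (_ * _)).
apply: eq_bigr => s xs; apply: eq_bigr => t xt.
by rewrite (swap_Omega R)// xO mul1r.
Qed.

Lemma Gamma_concentration (eps eta lam : R) : 0 < eps -> 0 < eta <= 2^-1 ->
  0 < lam <= 2^-1 -> 1 <= n%:R * eps ->
  (forall M, n%:R * eps / 2 <= M -> M <= 3 * (n%:R * eps) ->
    2 + beta / (2 * n%:R) * (2 * M + 1) * (4 * n%:R * p * (1 - p) + M)
    + 2 * lam * (n%:R + M) <= (2^-1 - eta) * M) ->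
  2 * N%:R * expR (- (lam * eta * (n%:R * eps))) <= eta / 2 ->
  2 * N%:R < expR (lam * (n%:R * eps)) ->
  let r := 4 * N%:R ^+ 2 / (lam * eta) * expR (- (lam * (n%:R * eps) / 2)) in
  r <= 2^-1 ->
  \sum_(x in Gamma n k p eps :\: Gamma n k p (eps / 2)) mu k beta x
  <= 2 * r * \sum_(x in Gamma n k p eps) mu k beta x.
Proof.
have arith (u d g v : R) : u <= d + g -> d <= v -> v <= 2^-1 * u -> u <= 2 * g.
  by lra.
move=> eps0 /andP[eta0 eta1] lam01 ne hB hN hK r hr.
case/andP: (lam01) => l0 l1.
pose m := n%:R * eps.
rewrite -/m in ne hB hN hK r hr *.
(* This level confines deviations on [U] to 3 m, the range covered by [hB], and still exceeds 2 N
   e^(2 lam m), which bounds V on Gamma_eps. *)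
pose V := lyap R n p lam; pose K := expR (3 * (lam * m)).
pose U := [set x in Omega n k | V x < K].
pose Gm := Gamma n k p eps; pose G := Gamma n k p (eps / 2).
have N0 : 0 < N%:R :> R by exact: N_gt0.
have m0 : 0 < m by lra.
have half_eps : 2 * n%:R * (eps / 2) = m by rewrite /m; field.
have UO x : x \in U -> x \in Omega n k by rewrite inE => /andP[].
have stepU : 0 <= \sum_(x in U) mu k beta x * drift R n p beta lam x.
  apply: le_trans (_ : \sum_(x in Omega n k) mu k beta x *
    (\sum_(s | x s) \sum_(t | ~~ x t) acc R n beta x s t *
      (Num.min (V (swap x s t)) K - Num.min (V x) K)) <= _).
    by rewrite (Kawasaki_stationary (fun x => Num.min (V x) K)).
  rewrite (big_setID U) /= (_ : Omega n k :&: U = U); last first.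
    by apply/finset.setIidPr; apply/fintype.subsetP => x /UO.
  rewrite -[leRHS]addr0; apply: lerD.
    apply: ler_sum => x xU; rewrite ler_wpM2l ?mu_ge0//.
    apply: ler_sum => s xs; apply: ler_sum => t xt.
    rewrite ler_wpM2l ?(ltW (acc_gt0 _ _ _ _ _ _))//.
    move: xU; rewrite inE => /andP[_ VK]; rewrite (min_idPl (ltW VK)).
    by rewrite lerD2r ge_min lexx.
  apply: sumr_le0 => x; rewrite finset.in_setD => /andP[+ xO].
  rewrite inE xO /= -leNgt => KV.
  rewrite mulr_ge0_le0 ?mu_ge0//.
  apply: sumr_le0 => s xs; apply: sumr_le0 => t xt.
  rewrite mulr_ge0_le0 ?(ltW (acc_gt0 _ _ _ _ _ _))// (min_idPr KV).
  by rewrite subr_le0 ge_min lexx orbT.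
have devU x e : x \in U -> `|dev R n p e x| <= 3 * m.
  rewrite inE => /andP[_ VK].
  have := le_lt_trans (lyap_ge R n p lam x e) VK.
  rewrite /K ltr_expR => h; rewrite -(ler_pM2l l0); lra.
have e1 : exists e : edge n, true.
  apply/existsP; rewrite -(negbK [exists _, _]) negb_exists.
  apply/negP => /forallP h; move: N0; rewrite /nedges -card_edge ltr0n.
  by case/card_gt0P => e _; have := h e.
have maxdev x : exists e0 : edge n, forall e, `|dev R n p e x| <= `|dev R n p e0 x|.
  case: e1 => e1 _.
  exists [arg max_(e > e1) `|dev R n p e x|]%O.
  by case: Order.TotalTheory.arg_maxP => // e _ he e'; exact: he.
(* With M the maximal deviation, the drift on [U] is at most - a for M >= m, at most 0 for m / 2 < M
   < m, and at most b for M <= m / 2. The gap between m / 2 and m makes b / a exponentially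
   small. *)
pose a := lam * (eta / 2) * N%:R * expR (lam * m).
pose b := 2 * N%:R ^+ 3 * expR (lam * m / 2).
have a0 : 0 < a by rewrite /a !mulr_gt0 ?expR_gt0 ?invr_gt0.
have b0 : 0 < b by rewrite /b !mulr_gt0 ?expR_gt0 ?exprn_gt0.
have bound x : x \in U -> drift R n p beta lam x <= b - a * (x \in U :\: G)%:R.
  move=> xU; have xO := UO x xU.
  have [e0 he0] := maxdev x.
  set M := `|dev R n p e0 x| in he0.
  have M0 : 0 <= M by exact: normr_ge0.
  have M3 : M <= 3 * m := devU x e0 xU.
  have [small|large] := leP M (m / 2).
    have -> : (x \in U :\: G) = false.
      rewrite finset.in_setD; apply/negbTE/nandP; left; rewrite negbK.
      apply/GammaP => //; split => // e.
      apply: le_trans (he0 e) _; apply: le_trans small _.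
      by rewrite half_eps ler_piMr ?(ltW m0)// invf_le1// ler1n.
    rewrite mulr0 subr0.
    apply: le_trans (drift_le_lyap R n k p beta kE p01 lam lam01 x xO) _.
    have -> : b = N%:R ^+ 2 * (2 * N%:R * expR (lam * m / 2)) by rewrite /b; ring.
    rewrite ler_wpM2l ?exprn_ge0 ?(ltW N0)//.
    rewrite -[lam * m / 2]mulrA; apply: lyap_le => // e.
    exact: le_trans (he0 e) small.
  have hNM : 2 * N%:R * expR (- (2 * lam * eta * M)) <= eta / 2.
    apply: le_trans hN; rewrite ler_wpM2l ?mulr_ge0 ?(ltW N0)// ler_expR lerN2.
    rewrite (_ : 2 * lam * eta * M = lam * eta * (2 * M)); last by ring.
    rewrite ler_wpM2l ?mulr_ge0 ?(ltW l0) ?(ltW eta0)//.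
    by move: (ltW large); rewrite ler_pdivrMr// mulrC.
  have eta01 : 0 < eta <= 2^-1 by rewrite eta0.
  have dn := drift_neg R n k p beta n_gt1 kE p01 beta_ge0 lam lam01 x e0 eta M
     xO eta01 erefl he0 (hB M (ltW large) M3) hNM.
  have c0 : 0 <= lam * N%:R * (eta / 2) * M * expR (lam * M).
    by rewrite !mulr_ge0 ?expR_ge0 ?invr_ge0 ?(ltW l0) ?(ltW N0) ?(ltW eta0).
  apply: le_trans dn _.
  have [xB|xB] := boolP (x \in U :\: G); last first.
    by rewrite mulr0 subr0; apply: le_trans (ltW b0); rewrite oppr_le0.
  rewrite mulr1.
  have mM : m <= M.
    move: xB; rewrite finset.in_setD => /andP[xG _].
    rewrite leNgt; apply: contra xG => Mm; apply/GammaP => //; split => // e.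
    by rewrite half_eps; apply: le_trans (he0 e) (ltW Mm).
  have : a <= lam * N%:R * (eta / 2) * M * expR (lam * M).
    have -> : a = lam * N%:R * (eta / 2) * (1 * expR (lam * m)) by rewrite /a; ring.
    rewrite -[leRHS]mulrA ler_wpM2l ?mulr_ge0 ?invr_ge0 ?(ltW l0) ?(ltW N0) ?(ltW eta0)//.
    by rewrite ler_pM ?expR_ge0// ?ler_expR ?ler_pM2l// (le_trans ne).
  by move=> ac; rewrite -[leLHS]add0r lerD ?(ltW b0)// lerN2.
have massU : a * \sum_(x in U :\: G) mu k beta x <= b * \sum_(x in U) mu k beta x.
  have : 0 <= \sum_(x in U) mu k beta x * (b - a * (x \in U :\: G)%:R).
    by apply: le_trans stepU _; apply: ler_sum => x xU; rewrite ler_wpM2l ?mu_ge0 ?bound.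
  have -> : \sum_(x in U) mu k beta x * (b - a * (x \in U :\: G)%:R)
    = b * \sum_(x in U) mu k beta x - a * \sum_(x in U :\: G) mu k beta x.
    rewrite !mulr_sumr [X in _ - X]big_mkcond [LHS]big_mkcond [X in X - _]big_mkcond.
    rewrite -sumrB; apply: eq_bigr => x _; rewrite finset.in_setD.
    by case: (x \in U); case: (x \in G); rewrite /= ?mulr0 ?mulr1 ?subr0; ring.
  by rewrite subr_ge0.
have rE : b = r * a.
  rewrite /b.
  have -> : expR (lam * m / 2) = expR (- (lam * m / 2)) * expR (lam * m).
    by rewrite -expRD; congr expR; field.
  by rewrite /r /a; field; rewrite !gt_eqF.
have massU2 : \sum_(x in U :\: G) mu k beta x <= r * \sum_(x in U) mu k beta x.
  by rewrite -(ler_pM2l a0) mulrA (mulrC a r) -rE.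
have r0 : 0 <= r by rewrite -(pmulr_lge0 _ a0) -rE ltW.
have GmU x : x \in Gm -> x \in U.
  move=> /GammaP -/(_ n_gt1)[xO h]; rewrite inE xO /=.
  apply: le_lt_trans (lyap_le R n p lam lam01 x (2 * m) _) _.
    by move=> e; rewrite /m mulrA; exact: h.
  rewrite /K (_ : 3 * (lam * m) = lam * m + lam * (2 * m)); last by ring.
  by rewrite expRD ltr_pM2r ?expR_gt0.
have GGm x : x \in G -> x \in Gm by apply: Gamma_half => //; exact: ltW.
have muU0 : 0 <= \sum_(x in U) mu k beta x by apply: sumr_ge0 => x _; exact: mu_ge0.
have sumle (A B : {set config n}) : A \subset B ->
    \sum_(x in A) mu k beta x <= \sum_(x in B) mu k beta x.
  move=> AB; rewrite [leLHS]big_mkcond [leRHS]big_mkcond; apply: ler_sum => x _.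
  have := fintype.subsetP AB x; case: (x \in A) => [->//|_].
  by case: ifP => _ //; exact: mu_ge0.
(* Passes from a bound relative to [U] to one relative to Gamma_eps: [U :\: G] carries at most half
   of the mass of [U]. *)
have massU3 : \sum_(x in U) mu k beta x <= 2 * \sum_(x in Gm) mu k beta x.
  have : \sum_(x in U) mu k beta x
     <= \sum_(x in U :\: G) mu k beta x + \sum_(x in Gm) mu k beta x.
    rewrite (big_setID G) /= addrC lerD2l; apply: sumle.
    by apply/fintype.subsetP => x; rewrite inE => /andP[_ /GGm].
  have : r * \sum_(x in U) mu k beta x <= 2^-1 * \sum_(x in U) mu k beta x.
    by rewrite ler_wpM2r.
  by move=> h1 h2; exact: arith h2 massU2 h1.
apply: (@le_trans _ _ (\sum_(x in U :\: G) mu k beta x)).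
  apply: sumle; apply/fintype.subsetP => x; rewrite !finset.in_setD => /andP[-> xG] /=.
  exact: GmU.
apply: le_trans massU2 _; rewrite -/Gm.
have -> : 2 * r * \sum_(x in Gm) mu k beta x = r * (2 * \sum_(x in Gm) mu k beta x).
  by rewrite [RHS]mulrCA mulrA.
exact: ler_wpM2l r0 _ _ massU3.
Qed.

End Concentration.

(** * Conclusion *)

(** The gap is 4 eta so that three eta can absorb error terms, both in the contraction rate and in
    the drift, and one remains. *)
Lemma compact_gap (R : realType) (B : set (R * R)) :
  compact B -> (B `<=` @R_Kaw R)%classic ->
  exists eta b : R, [/\ 0 < eta <= 2^-1, 1 <= b &
    forall p beta, B (p, beta) -> [/\ 0 < p < 1, 0 <= beta <= b &
      4 * beta * p * (1 - p) <= 2^-1 - 4 * eta]].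
Proof.
move=> cB BK.
have [->|B0] := eqVneq B set0.
  by exists 2^-1, 1; split => //; rewrite invr_gt0 ltr0n lexx.
have {}B0 : (B !=set0)%classic by apply/set0P.
pose g (q : R * R) := 2^-1 - 4 * q.2 * q.1 * (1 - q.1).
have cg : continuous g.
  move=> q; apply: cvgB; first exact: cvg_cst.
  apply: cvgM; last by apply: cvgB; [exact: cvg_cst|exact: cvg_fst].
  apply: cvgM; last exact: cvg_fst.
  by apply: cvgM; [exact: cvg_cst|exact: cvg_snd].
have c2 : continuous (fun q : R * R => q.2) by move=> q; exact: cvg_snd.
have [q0 /set_mem q0B hq0] := compact_EVT_min B0 cB (continuous_subspaceT cg).
have [q1 /set_mem q1B hq1] := compact_EVT_max B0 cB (continuous_subspaceT c2).
have g0 : 0 < g q0.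
  by have [_ _ h] := BK _ q0B; rewrite /g subr_gt0.
exists (Num.min (g q0 / 4) 2^-1), (Num.max 1 q1.2); split.
- by rewrite lt_min divr_gt0//= invr_gt0 ltr0n /= ge_min lexx orbT.
- by rewrite le_max lexx.
move=> p beta pB; have [/= p01 /andP[b0 _] _] := BK _ pB; split => //.
  by rewrite b0 /= le_max (hq1 (p, beta)) ?orbT// inE.
have := hq0 (p, beta) (mem_set pB); rewrite {2}/g /=.
have : Num.min (g q0 / 4) 2^-1 <= g q0 / 4 by rewrite ge_min lexx.
lra.
Qed.

(** Either V is below the exponential error, or V <= 4 E, or the bounds on the iterate are compared.
    In the last case S e^(- c n) < V turns e^(- 2 c n) S into e^(- c n) V. *)
Lemma iterate_comparison (R : realType) (n : nat) (c V E S a : R) :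
  (0 < n)%N -> 0 < c -> 0 <= E -> 0 <= S ->
  a <= S * expR (- (2 * c * n%:R)) ->
  (0 < V - 2 * E -> (V - 2 * E) ^+ (n ^ 3) * V <= a * V ^+ (n ^ 3)) ->
  V <= (4 + 4 / c) * n%:R ^+ 2 * E + (4 + 4 / c) * expR (- c * n%:R) * S.
Proof.
move=> n0 c0 E0 S0 ha hV.
have nR : 1 <= n%:R :> R by rewrite ler1n.
have n2 : 1 <= n%:R ^+ 2 :> R by rewrite exprn_ege1.
have C0 : 0 < 4 / c by rewrite divr_gt0.
have ec := expR_gt0 (- c * n%:R).
have nE : 0 <= n%:R ^+ 2 * E by rewrite mulr_ge0// exprn_ge0.
have eS : 0 <= expR (- c * n%:R) * S by rewrite mulr_ge0// ltW.
have CnE : 0 <= 4 / c * (n%:R ^+ 2 * E) by rewrite mulr_ge0// ltW.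
have CeS : 0 <= 4 / c * (expR (- c * n%:R) * S) by rewrite mulr_ge0// ltW.
rewrite -!mulrA !mulrDl.
have [small|large] := leP V (expR (- c * n%:R) * S); first by lra.
have V0 : 0 < V by apply: le_lt_trans large.
have [dirichlet|L2] := leP (V - 2 * E) (V / 2).
  have EnE : E <= n%:R ^+ 2 * E by rewrite ler_peMl.
  by lra.
have L0 : 0 < V - 2 * E by apply: lt_trans L2; rewrite divr_gt0.
have {}hV := hV L0.
pose u := 2 * E / V.
have u0 : 0 <= u by rewrite /u divr_ge0 ?mulr_ge0// ltW.
have u1 : u <= 2^-1.
  by rewrite /u ler_pdivrMr//; lra.
have LE : V - 2 * E = V * (1 - u) by rewrite /u; field; rewrite gt_eqF.
(* For u <= 1/2, since (1 - u) (1 + 2 u) = 1 + u (1 - 2 u) >= 1. *)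
have eu : expR (- (2 * u)) <= 1 - u.
  rewrite expRN -[leLHS]mul1r ler_pdivrMr ?expR_gt0//.
  apply: le_trans (_ : (1 - u) * (1 + 2 * u) <= _).
    have : 0 <= u * (1 - 2 * u) by rewrite mulr_ge0//; lra.
    lra.
  by rewrite ler_wpM2l ?expR_ge1Dx//; lra.
have key : expR (- (2 * u)) ^+ (n ^ 3) <= expR (- c * n%:R).
  apply: le_trans (_ : (1 - u) ^+ (n ^ 3) <= _).
    by rewrite lerXn2r ?nnegrE ?expR_ge0//; lra.
  rewrite -(ler_pM2l (_ : 0 < V * V ^+ (n ^ 3))); last by rewrite mulr_gt0 ?exprn_gt0.
  rewrite LE exprMn in hV.
  apply: (@le_trans _ _ (a * V ^+ (n ^ 3))).
    by apply: le_trans hV; rewrite le_eqVlt; apply/orP; left; apply/eqP; ring.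
  rewrite mulrAC ler_wpM2r ?exprn_ge0 ?(ltW V0)//.
  apply: le_trans ha _.
  have -> : - (2 * c * n%:R) = - c * n%:R + - c * n%:R by ring.
  by rewrite expRD mulrA ler_wpM2r ?(ltW ec)// mulrC ltW.
rewrite -expRM_natl ler_expR natrX in key.
have cu : c <= 2 * n%:R ^+ 2 * u.
  rewrite -(ler_pM2l (_ : 0 < n%:R :> R)) ?ltr0n//.
  have -> : n%:R * (2 * n%:R ^+ 2 * u) = n%:R ^+ 3 * (2 * u) by ring.
  lra.
have VE : V <= 4 / c * (n%:R ^+ 2 * E).
  rewrite mulrAC ler_pdivlMr//.
  have := ler_wpM2l (ltW V0) cu.
  have -> : V * (2 * n%:R ^+ 2 * u) = 4 * (n%:R ^+ 2 * E).
    by rewrite /u; field; rewrite gt_eqF.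
  by [].
by lra.
Qed.

Lemma nedges_le (R : realType) n : (nedges n)%:R <= n%:R ^+ 2 :> R.
Proof.
rewrite -natrX ler_nat expnS expn1 /nedges.
by have := bin2_sqr n; move: ('C(n, 2)); lia.
Qed.

Lemma nedges_ge (R : realType) n : (1 < n)%N -> n%:R <= 2 * (nedges n)%:R :> R.
Proof.
move=> n1; rewrite -natrM ler_nat /nedges.
by have := bin2_sqr n; move: ('C(n, 2)) => m; nia.
Qed.

Section WeakPoincare.
Variables (R : realType) (n k : nat) (p beta eps eta : R).
Local Notation N := (nedges n).
Local Notation Gm := (Gamma n k p eps).
Local Notation G := (Gamma n k p (eps / 2)).
Local Notation Pe := (@P_eps R n k p beta eps).
Local Notation pie := (pi_eps k p beta eps).
Hypothesis n_gt1 : (1 < n)%N.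
Hypothesis kE : k%:R = N%:R * p.
Hypothesis p01 : 0 < p < 1.
Hypothesis beta_ge0 : 0 <= beta.
Hypothesis eps_gt0 : 0 < eps.
Hypothesis n_eps : 1 <= n%:R * eps.
Hypothesis eta01 : 0 < eta <= 2^-1.
Hypothesis etaE : eta <=
  2^-1 - 4 * beta * p * (1 - p) - 2 * beta * eps - beta / (2 * n%:R) - N%:R^-1.

Lemma weak_poincare (c rho : R) (f : config n -> R) : 0 < c ->
  \sum_(x in Gm :\: G) mu k beta x <= rho * \sum_(x in Gm) mu k beta x ->
  8 * (expR (- (eta * n%:R)) * n%:R ^+ 2 + 2 * n%:R ^+ 3 * rho)
    <= expR (- (2 * c * n%:R)) ->
  var_on Gm pie f <= (4 + 4 / c) * n%:R ^+ 2 * Dir_eps k p beta eps f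
       + (4 + 4 / c) * expR (- c * n%:R) * supnorm_on Gm f ^+ 2.
Proof.
move=> c0 hrho hq; case/andP: (eta01) => eta0 eta1.
have N0 : 0 < N%:R :> R by exact: N_gt0.
have C0 : 0 <= 4 + 4 / c by rewrite addr_ge0// divr_ge0// ltW.
(* On an empty regular set [pi_eps] is not a probability, but variance and energy are empty sums. *)
have [Gm0|[z zG]] := set_0Vmem Gm.
  have -> : var_on Gm pie f = 0 by rewrite /var_on Gm0 big_set0.
  have -> : Dir_eps k p beta eps f = 0 by rewrite /Dir_eps Gm0 big_set0 mulr0.
  by rewrite mulr0 add0r mulr_ge0 ?sqr_ge0// mulr_ge0 ?expR_ge0.
have pi0 := pi_eps_ge0 R n k p beta eps.
have pi1 := pi_eps_sum1 R n k p beta eps n_gt1 z zG.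
have P0 := P_eps_ge0 R n k p beta eps n_gt1 kE p01.
have P1 := P_eps_sum1 R n k p beta eps.
have Prev := P_eps_rev R n k p beta eps.
set S := supnorm_on Gm f.
have S0 : 0 <= S by exact: bigmax_ge_id.
have fS x : x \in Gm -> `|f x| <= S.
  by move=> xG; rewrite /S /supnorm_on; apply: (le_bigmax_cond _ (fun x => `|f x|)).
pose F x := f x - mean_on Gm pie f.
have meanS : `|mean_on Gm pie f| <= S.
  apply: le_trans (ler_norm_sum _ _ _) _; rewrite -[leRHS]mul1r -pi1 mulr_suml.
  by apply: ler_sum => x xG; rewrite normrM ger0_norm// ler_wpM2l// fS.
have FS x : x \in Gm -> `|F x| <= 2 * S.
  by move=> xG; apply: le_trans (ler_normB _ _) _; have := fS x xG; lra.
have F0 : \sum_(x in Gm) pie x * F x = 0.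
  under eq_bigr do rewrite mulrBr.
  by rewrite sumrB -mulr_suml pi1 mul1r subrr.
have varE : var_on Gm pie f = dot_on R _ Gm pie F F.
  by apply: eq_bigr => x _; rewrite expr2.
have dirE : Dir_eps k p beta eps f = dir_on R _ Gm pie Pe F.
  congr (_ * _); apply: eq_bigr => x _; apply: eq_bigr => y _; congr (_ * _).
  by rewrite /F; ring.
have kap01 : 0 <= eta / N%:R <= 1.
  rewrite divr_ge0 ?(ltW eta0) ?(ltW N0)//= ler_pdivrMr// mul1r.
  apply: le_trans eta1 _; apply: le_trans (_ : 1 <= _); first by rewrite invf_le1// ler1n.
  by rewrite ler1n bin_gt0.
have bad : \sum_(x in Gm :\: G) pie x <= rho.
  have mG := mu_Gamma_gt0 R n k p beta eps n_gt1 z zG.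
  rewrite -(ler_pM2r mG); apply: le_trans hrho.
  rewrite mulr_suml; apply: ler_sum => x; rewrite finset.in_setD => /andP[_ xG].
  by rewrite /pi_eps /cond_meas xG divfK ?lt0r_neq0.
have contr := P_eps_contraction R n k p beta eps n_gt1 kE p01 eta beta_ge0 eps_gt0
  n_eps (ltW eta0) etaE.
have upper := dot_on_iter_upper R _ Gm pie Pe pi0 pi1 P0 P1 Prev G (hd R n) (eta / N%:R)
   kap01 (hd_ge0 R n) (hd_ge1 R n) contr F (2 * S) (n ^ 3) N%:R
   (mulr_ge0 (ler0n _ 2) S0) FS F0 (hd_le R n).
have lower := dot_on_iter_lower R _ Gm pie Pe pi0 P0 P1 Prev F (n ^ 3).
rewrite varE dirE.
apply: (@iterate_comparison R n c _ _ _
  (dot_on R _ Gm pie (iter (n ^ 3) (op_on R _ Gm Pe) F)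
    (iter (n ^ 3) (op_on R _ Gm Pe) F))) => //.
- exact: ltnW.
- exact: dir_on_ge0.
- exact: sqr_ge0.
apply: le_trans upper _.
have decay : (1 - eta / N%:R) ^+ (n ^ 3) <= expR (- (eta * n%:R)).
  apply: (@le_trans _ _ (expR (- (eta / N%:R)) ^+ (n ^ 3))).
    case/andP: kap01 => k0 k1.
    by rewrite lerXn2r ?nnegrE ?subr_ge0 ?expR_ge0// expR_ge1Dx.
  rewrite -expRM_natl ler_expR mulrN lerN2 natrX.
  rewrite mulrCA ler_wpM2l ?(ltW eta0)// ler_pdivlMr// exprS.
  by rewrite ler_wpM2l// nedges_le.
(* The centred function is bounded by 2 S, not by S. *)
have -> : 2 * (2 * S) ^+ 2 = S ^+ 2 * 8 by ring.
rewrite -[S ^+ 2 * 8 * _]mulrA; apply: ler_wpM2l; first exact: sqr_ge0.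
apply: le_trans hq; rewrite ler_wpM2l//; apply: lerD.
  rewrite ler_pM ?nedges_le//.
  by case/andP: kap01 => k0 k1; rewrite exprn_ge0// subr_ge0.
by rewrite natrX ler_wpM2l// mulr_ge0// exprn_ge0.
Qed.

End WeakPoincare.

(** The leading term leaves 3 eta M. The quadratic term beta M^2 / n takes eta M, as M / n <= 3 eps
    and 3 b eps <= eta; with lam = eta eps / 24 the lam terms take eta M / 4; the constants fit
    because eta M >= 3 + b. *)
Lemma drift_condition (R : realType) (n : nat) (p beta b eps eta lam M : R) :
  (0 < n)%N -> 0 < p < 1 -> 0 <= beta <= b -> 1 <= b -> 0 < eta <= 2^-1 ->
  0 < eps -> 3 * b * eps <= eta -> lam = eta * eps / 24 ->
  4 * beta * p * (1 - p) <= 2^-1 - 4 * eta -> 6 + 2 * b <= eta * (n%:R * eps) ->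
  n%:R * eps / 2 <= M -> M <= 3 * (n%:R * eps) ->
  2 + beta / (2 * n%:R) * (2 * M + 1) * (4 * n%:R * p * (1 - p) + M)
    + 2 * lam * (n%:R + M) <= (2^-1 - eta) * M.
Proof.
move=> n0 /andP[p0 p1] /andP[b0 bb] b1 /andP[eta0 eta1] eps0 beps lamE gap hn M1 M2.
have nR : 0 < n%:R :> R by rewrite ltr0n.
have ne : 0 < n%:R * eps by rewrite mulr_gt0.
have M0 : 0 <= M by lra.
have -> : beta / (2 * n%:R) * (2 * M + 1) * (4 * n%:R * p * (1 - p) + M)
  = 4 * beta * p * (1 - p) * M + 2 * beta * p * (1 - p)
    + beta * (M / n%:R) * M + beta * (M / n%:R) / 2 by field; rewrite gt_eqF.
have t1 : 4 * beta * p * (1 - p) * M <= (2^-1 - 4 * eta) * M by rewrite ler_wpM2r.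
have t2 : 2 * beta * p * (1 - p) <= 2^-1 by lra.
have Mn : 0 <= M / n%:R <= 3 * eps.
  by rewrite divr_ge0 ?(ltW nR)//= ler_pdivrMr//; lra.
case/andP: Mn => Mn0 Mn3.
have t3 : beta * (M / n%:R) <= eta.
  apply: le_trans beps; rewrite (_ : 3 * b * eps = b * (3 * eps)); last by ring.
  exact: ler_pM.
have t4 : beta * (M / n%:R) * M <= eta * M by rewrite ler_wpM2r.
have t5 : 6 + 2 * b <= eta * (2 * M).
  by apply: le_trans hn _; rewrite ler_pM2l//; lra.
have eps1 : eps <= 1.
  have : eps <= b * eps by rewrite ler_peMl// ltW.
  lra.
have t6 : 2 * lam * n%:R <= eta * M / 6.
  have -> : 2 * lam * n%:R = eta * (n%:R * eps) / 12 by rewrite lamE; field.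
  have : eta * (n%:R * eps) <= eta * (2 * M) by rewrite ler_pM2l//; lra.
  lra.
have etaM : 0 <= eta * M by rewrite mulr_ge0// ltW.
have t7 : 2 * lam * M <= eta * M / 12.
  have -> : 2 * lam * M = eta * M * eps / 12 by rewrite lamE; field.
  have : eta * M * eps <= eta * M by rewrite ler_piMr.
  lra.
lra.
Qed.

Theorem theorem2p2 (R : realType) (B : set (R * R)) :
  compact B -> (B `<=` @R_Kaw R)%classic ->
  exists eps0 : R, 0 < eps0 /\
  forall eps : R, 0 < eps <= eps0 ->
  exists (C c : R) (n0 : nat), 0 < c /\
  forall p beta : R, B (p, beta) ->
  forall n k : nat, (n0 <= n)%N -> k%:R = (nedges n)%:R * p ->
  forall f : config n -> R,
    var_on (Gamma n k p eps) (pi_eps k p beta eps) f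
    <= C * n%:R ^+ 2 * Dir_eps k p beta eps f
       + C * expR (- c * n%:R) * supnorm_on (Gamma n k p eps) f ^+ 2.
Proof.
move=> cB BK; have [eta [b [eta01 b1 hB]]] := compact_gap R B cB BK.
case/andP: (eta01) => eta0 eta1.
have b0 : 0 < b by apply: lt_le_trans b1.
exists (eta / (3 * b)); split; first by rewrite divr_gt0// mulr_gt0.
move=> eps /andP[eps0 epsE].
have beps : 3 * b * eps <= eta.
  by move: epsE; rewrite ler_pdivlMr ?mulr_gt0// mulrC.
have eps1 : eps <= 1.
  have : eps <= b * eps by rewrite ler_peMl// ltW.
  lra.
(* The layer has relative mass e^(- th n) up to a polynomial. Half of this exponent absorbs the
   polynomial, and the other half is 2 c n. *)
pose lam := eta * eps / 24; pose th := lam * eps / 2; pose c := th / 4.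
have lam0 : 0 < lam by rewrite !mulr_gt0 ?invr_gt0.
have th0 : 0 < th by rewrite !mulr_gt0 ?invr_gt0.
have c0 : 0 < c by rewrite divr_gt0.
have ee : eta * eps <= eta by rewrite ler_piMr// ltW.
have lam1 : lam <= 2^-1 by rewrite /lam; lra.
have theta : th <= eta.
  have : lam * eps <= lam by rewrite ler_piMr// ltW.
  by rewrite /th /lam; lra.
(* Sized for 32 A n^3 + 8 n^2 below; the power 7 is n^4 from N^2 in [A] times n^3 steps. *)
pose K := 8 * (1 + 16 / (lam * eta)).
have le0 : 0 < lam * eta by rewrite mulr_gt0.
have [n1 hn1] := expR_dominates R K (th / 2) 7 (divr_gt0 th0 (ltr0Sn _ 1)).
have [n2 hn2] := expR_dominates R (4 / eta) (lam * eta * eps) 2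
  (mulr_gt0 le0 eps0).
pose n3 := Num.bound ((6 + 2 * b) / (eta * eps)).
exists (4 + 4 / c), c, (maxn 2 (maxn n1 (maxn n2 n3))); split => //.
move=> p beta pB n k; rewrite !geq_max => /and4P[n_gt1 nn1 nn2 nn3] kE f.
have [p01 b0b gap] := hB p beta pB; case/andP: (b0b) => beta0 betab.
have n0 : 0 < n%:R :> R by rewrite ltr0n ltnW.
have n1R : 1 <= n%:R :> R by rewrite ler1n ltnW.
have h3 : 6 + 2 * b <= eta * (n%:R * eps).
  rewrite mulrCA -ler_pdivrMr ?mulr_gt0//; apply: ltW.
  apply: lt_le_trans (archi_boundP _) _; first last.
    by rewrite ler_nat.
  by rewrite divr_ge0 ?mulr_ge0 ?addr_ge0 ?mulr_ge0 ?(ltW b0) ?(ltW eta0) ?(ltW eps0).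
have ne : 1 <= n%:R * eps.
  have : eta * (n%:R * eps) <= 2^-1 * (n%:R * eps).
    by rewrite ler_wpM2r ?mulr_ge0 ?(ltW n0) ?(ltW eps0).
  lra.
have etan : 6 + 2 * b <= eta * n%:R.
  by apply: le_trans h3 _; rewrite ler_pM2l// ler_piMr// ltW.
have {}hn1 := hn1 n nn1; have {}hn2 := hn2 n nn2.
have Nle := nedges_le R n; have Nge := nedges_ge R n n_gt1.
have Npos : 0 < (nedges n)%:R :> R by exact: N_gt0.
have etaE : eta <= 2^-1 - 4 * beta * p * (1 - p) - 2 * beta * eps
   - beta / (2 * n%:R) - (nedges n)%:R^-1.
  have e1 : 2 * beta * eps <= eta.
    apply: le_trans beps; rewrite ler_wpM2r ?(ltW eps0)//; lra.
  have e2 : beta / (2 * n%:R) <= eta.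
    by rewrite ler_pdivrMr ?mulr_gt0//; lra.
  have e3 : (nedges n)%:R^-1 <= eta.
    rewrite -[leLHS]mul1r ler_pdivrMr//.
    have : eta * n%:R <= eta * (2 * (nedges n)%:R) by rewrite ler_pM2l.
    lra.
  lra.
have lam01 : 0 < lam <= 2^-1 by rewrite lam0.
pose m := n%:R * eps.
pose X := expR (lam * eta * m); pose Y := expR (th / 2 * n%:R).
have X0 : 0 < X := expR_gt0 _; have Y0 : 0 < Y := expR_gt0 _.
have hX : 4 / eta * n%:R ^+ 2 <= X.
  by apply: le_trans hn2 _; rewrite ler_expR /m; lra.
have Y1 : 1 <= Y.
  by apply: le_trans (expR_ge1Dx _); rewrite lerDl mulr_ge0// divr_ge0// ltW.
have hN : 2 * (nedges n)%:R * expR (- (lam * eta * m)) <= eta / 2.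
  rewrite expRN -/X ler_pdivrMr//.
  have : eta / 2 * (4 / eta * n%:R ^+ 2) <= eta / 2 * X by rewrite ler_pM2l// divr_gt0.
  have -> : eta / 2 * (4 / eta * n%:R ^+ 2) = 2 * n%:R ^+ 2 by field; rewrite gt_eqF.
  lra.
have hK : 2 * (nedges n)%:R < expR (lam * m).
  have XE : X <= expR (lam * m).
    rewrite ler_expR mulrAC ler_piMr ?mulr_ge0 ?(ltW lam0) ?(ltW n0) ?(ltW eps0)//; lra.
  apply: lt_le_trans XE; apply: lt_le_trans hX.
  apply: (@le_lt_trans _ _ (2 * n%:R ^+ 2)); first by rewrite ler_pM2l.
  rewrite ltr_pM2r ?exprn_gt0// ltr_pdivlMr//; lra.
pose A := 4 * (nedges n)%:R ^+ 2 / (lam * eta).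
have A0 : 0 <= A.
  by apply: divr_ge0; [rewrite mulr_ge0// exprn_ge0|exact: ltW].
have An : A <= 4 / (lam * eta) * n%:R ^+ 4.
  have -> : 4 / (lam * eta) * n%:R ^+ 4 = 4 * (n%:R ^+ 2) ^+ 2 / (lam * eta).
    by rewrite -exprM; ring.
  rewrite /A ler_pM2r ?invr_gt0// ler_pM2l// lerXn2r ?nnegrE ?exprn_ge0//.
have YE : expR (- (lam * m / 2)) = Y^-1 * Y^-1.
  by rewrite /Y -expRN -expRD; congr expR; rewrite /m /th; field.
pose r := A * expR (- (lam * m / 2)).
have npow j : (j <= 7)%N -> n%:R ^+ j <= n%:R ^+ 7 :> R.
  by move=> j7; rewrite ler_weXn2l.
have An7 : 32 * A * n%:R ^+ 3 + 8 * n%:R ^+ 2 <= Y.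
  apply: le_trans hn1.
  have a1 : A * n%:R ^+ 3 <= 4 / (lam * eta) * n%:R ^+ 7.
    have -> : 4 / (lam * eta) * n%:R ^+ 7 = 4 / (lam * eta) * n%:R ^+ 4 * n%:R ^+ 3.
      by rewrite -[RHS]mulrA -exprD.
    by rewrite ler_wpM2r ?exprn_ge0.
  have := npow 2 isT; rewrite /K; lra.
have A32 : 32 * A <= Y.
  apply: le_trans An7; have : A <= A * n%:R ^+ 3 by rewrite ler_peMr// exprn_ege1.
  have : 0 <= n%:R ^+ 2 :> R by rewrite exprn_ge0.
  lra.
have hr : r <= 2^-1.
  rewrite /r YE mulrA ler_pdivrMr// ler_pdivrMr//.
  have : Y <= Y * Y by rewrite ler_peMr// ltW.
  lra.
have conc := Gamma_concentration R n k p beta n_gt1 kE p01 beta0 eps eta lam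
  eps0 eta01 lam01 ne (fun M => drift_condition R n p beta b eps eta lam M
    (ltnW n_gt1) p01 b0b b1 eta01 eps0 beps erefl gap h3) hN hK hr.
apply: (weak_poincare R n k p beta eps eta n_gt1 kE p01 beta0 eps0 ne eta01 etaE
  c _ f c0 conc).
have -> : expR (- (2 * c * n%:R)) = Y^-1.
  by rewrite /Y -expRN; congr expR; rewrite /c; field.
have decay : expR (- (eta * n%:R)) <= Y^-1 * Y^-1.
  rewrite -YE ler_expR lerN2 (_ : lam * m / 2 = th * n%:R); last by rewrite /th /m; field.
  by rewrite ler_wpM2r// ltW.
rewrite -/m -/A YE.
apply: (@le_trans _ _ ((32 * A * n%:R ^+ 3 + 8 * n%:R ^+ 2) * (Y^-1 * Y^-1))).
  have : expR (- (eta * n%:R)) * n%:R ^+ 2 <= Y^-1 * Y^-1 * n%:R ^+ 2.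
    by rewrite ler_wpM2r ?exprn_ge0.
  lra.
rewrite mulrA ler_pdivrMr// mulVf ?lt0r_neq0//.
by rewrite ler_pdivrMr// mul1r.
Qed.
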